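(* Let $N_1,N_2,\Sigma_1,\Sigma_2,\Omega_1,\Omega_2,\kappa<1$ and $p_2$ be as described in the context. Let $f\in L^1(\Omega_1)$ with $f>0$ a.e., let $m_1,\dots,m_N\in\Omega_2$ be distinct points, and let $g_1,\dots,g_N$ be positive numbers satisfying $\int_{\Omega_1}f\,dx=\sum_{i=1}^N g_i$. For $b>0$ and $m\in\Omega_2$ put $$h_{b,m}(x)=\frac{b}{1-x\cdot p_2(m)},\qquad x\in\Omega_1 .$$ Then for each $0<b_1<\infty$ there exist unique positive numbers $b_2,\dots,b_N$ such that $$S=\{\rho(x)x:x\in\Omega_1\}\quad\text{with}\quad \rho(x)=\min_{1\le i\le N}h_{b_i,m_i}(x)$$ is a weak solution to the refractor problem with data $f$ and $\mu=\sum_{i=1}^N g_i\,\delta_{m_i}$. In addition, $\mathcal{M}_{S,f}(\{m_i\})=g_i$ for $1\le i\le N$.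
   Context: Setting. $N_1,N_2$ are norms in $\mathbb{R}^n$ ($n\ge 2$), $\Sigma_i=\{x\in\mathbb{R}^n:N_i(x)=1\}$, $i=1,2$. Both $\Sigma_1$ and $\Sigma_2$ are $C^1$ (equivalently $N_i\in C^1(\mathbb{R}^n\setminus\{0\})$) and strictly convex (contain no nondegenerate segment). Put $p_i=\nabla N_i$. It is assumed that $$\kappa:=\sup_{N_1(x)=1}N_2(x)<1 .$$ $\Omega_1\subset\Sigma_1$ and $\Omega_2\subset\Sigma_2$ are closed domains (closures of nonempty connected relatively open sets) such that: the surface measure of the boundary of $\Omega_1$ (relative to $\Sigma_1$) is zero; and $\inf_{x\in\Omega_1,\,m\in\Omega_2}m\cdot p_1(x)\ge 1$. Here $\cdot$ is the Euclidean inner product, and $dx$ denotes surface measure on $\Sigma_1$. (Under these assumptions $1-x\cdot p_2(m)\ge 1-\kappa>0$ for $x\in\Sigma_1$, $m\in\Sigma_2$.) Refractor. A surface $S=\{\rho(x)x:x\in\Omega_1\}$ with $\rho\in C(\Omega_1)$, $\rho>0$, is a refractor from $\Omega_1$ to $\Omega_2$ if for each $x_0\in\Omega_1$ there exist $m\in\Omega_2$ and $b>0$ such that $$\rho(x)\le\frac{b}{1-x\cdot p_2(m)}\quad\text{for all }x\in\Omega_1,\text{ with equality at }x=x_0. \qquad ( * )$$ The refractor mapping of $S$ is the set-valued map $$\mathcal{R}_S(x_0)=\{m\in\Omega_2:\ ( * )\text{ holds for some }b>0\},\qquad x_0\in\Omega_1 .$$ Refractor measure. For $f\in L^1(\Omega_1)$,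 $f\ge0$, and Borel $E\subset\Omega_2$, $$\mathcal{M}_{S,f}(E)=\int_{\mathcal{R}_S^{-1}(E)}f(x)\,dx,\qquad \mathcal{R}_S^{-1}(E)=\{x\in\Omega_1:\mathcal{R}_S(x)\cap E\ne\emptyset\};$$ this is a Borel measure on $\Omega_2$. Weak solution. Let $\mu$ be a Radon measure in $\Omega_2$ with $\int_{\Omega_1}f\,dx=\mu(\Omega_2)$. A refractor $S$ from $\Omega_1$ to $\Omega_2$ is a weak solution of the refractor problem (with data $f,\mu$) if $\mathcal{M}_{S,f}(E)=\mu(E)$ for each Borel set $E\subset\Omega_2$. *)

(* Defs.v *)
From HB Require Import structures.
From mathcomp Require Import all_boot all_order all_algebra.
From mathcomp Require Import all_classical all_reals all_analysis.

Set Implicit Arguments.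
Unset Strict Implicit.
Unset Printing Implicit Defensive.

Import Order.TTheory GRing.Theory Num.Theory.
Import numFieldNormedType.Exports.

Local Open Scope classical_set_scope.
Local Open Scope ring_scope.

(* The ambient space is 'rV[R]_n.  Its library topology is the Euclidean one,
   but its library norm `|_| is the sup norm, so the Euclidean structure is
   defined here. *)
Section euclidean.
Context {R : realType} {n : nat}.
Implicit Types x y : 'rV[R]_n.

Definition dotp x y : R := \sum_(i < n) x ord0 i * y ord0 i.

Definition enorm x : R := Num.sqrt (dotp x x).

Definition grad (N : 'rV[R]_n -> R) x : 'rV[R]_n :=
  \row_i 'D_(delta_mx ord0 i) N x.

(* [sup] is 0 on the empty set and on unbounded sets; below, diameters are only
   taken of bounded sets. *)
Definition ediam (U : set 'rV[R]_n) : R :=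
  sup [set enorm (u.1 - u.2) | u in U `*` U].

End euclidean.

Section hausdorff.
Context {R : realType} {n : nat}.
Local Open Scope ereal_scope.
Implicit Types (A U : set 'rV[R]_n) (d : nat) (delta : R).

(* Lebesgue measure of the unit ball of R^d. *)
Fixpoint unit_ball_volume d : R :=
  match d with
  | 0 => 1
  | 1 => 2
  | d'.+2 => 2 * pi / d%:R * unit_ball_volume d'
  end%R.

(* The normalization makes the d-dimensional Hausdorff measure agree with
   d-dimensional area. The case U = set0 matters only for d = 0, as 0 ^+ 0 = 1. *)
Definition hausdorff_weight d U : \bar R :=
  if `[< U = set0 >] then 0
  else (unit_ball_volume d * (ediam U / 2) ^+ d)%:E.

Definition delta_cover delta A : set (nat -> set 'rV[R]_n) :=
  [set U | (forall k x y, U k x -> U k y -> (enorm (x - y) <= delta)%R) /\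
           A `<=` \bigcup_k U k].

Definition hausdorff_pre d delta A : \bar R :=
  ereal_inf [set \sum_(k <oo) hausdorff_weight d (U k)
            | U in delta_cover delta A].

Definition hausdorff d A : \bar R :=
  ereal_sup [set hausdorff_pre d delta A | delta in [set delta | (0 < delta)%R]].

Lemma ediam_ge0 U : (0 <= ediam U)%R.
Proof.
rewrite /ediam; set D := (X in sup X).
have D0 r : D r -> (0 <= r)%R by move=> [u _ <-]; exact: sqrtr_ge0.
have [[[r Dr] [M DM]]|/sup_out ->//] := pselect (has_sup D).
by rewrite (le_trans (D0 _ Dr))// ub_le_sup//; exists M.
Qed.

Lemma unit_ball_volume_ge0 d : (0 <= unit_ball_volume d)%R.
Proof.
suff : (0 <= unit_ball_volume d /\ 0 <= unit_ball_volume d.+1)%R by case.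
elim: d => [|d [IH1 IH2]]; first by [].
by split=> //=; rewrite mulr_ge0// divr_ge0// mulr_ge0// pi_ge0.
Qed.

Lemma hausdorff_weight_ge0 d U : 0 <= hausdorff_weight d U.
Proof.
rewrite /hausdorff_weight; case: ifP => // _; rewrite lee_fin.
by rewrite mulr_ge0 ?unit_ball_volume_ge0// exprn_ge0// divr_ge0// ediam_ge0.
Qed.

Lemma hausdorff_pre_ge0 d delta A : 0 <= hausdorff_pre d delta A.
Proof.
apply: le_ereal_inf_tmp => _ [U _ <-]; apply: nneseries_ge0 => k _ _.
exact: hausdorff_weight_ge0.
Qed.

Lemma hausdorff_pre0 d delta : hausdorff_pre d delta set0 = 0.
Proof.
apply/eqP; rewrite eq_le hausdorff_pre_ge0 andbT.
apply: ereal_inf_lbound; exists (fun=> set0); first by split.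
by rewrite eseries0// => k _ _; rewrite /hausdorff_weight asboolT.
Qed.

Lemma le_hausdorff_pre d delta :
  {homo hausdorff_pre d delta : A B / A `<=` B >-> A <= B}.
Proof.
move=> A B AB; apply: ereal_inf_le_tmp => _ [U [Ud BU] <-].
by exists U => //; split=> //; exact: subset_trans BU.
Qed.

Lemma hausdorff_pre_sigma_subadditive d delta :
  sigma_subadditive (hausdorff_pre d delta).
Proof.
set mu := hausdorff_weight d; set nu := hausdorff_pre d delta.
have mu0 U : 0 <= mu U by exact: hausdorff_weight_ge0.
move=> A; have [[i ioo]|] := pselect (exists i, nu (A i) = +oo).
  rewrite (eseries_pinfty _ _ ioo) ?leey// => k _.
  by rewrite -ltNye (lt_le_trans _ (hausdorff_pre_ge0 _ _ _)).
rewrite -forallNE => Aoo.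
apply/lee_addgt0Pr => e e0.
rewrite (le_trans _ (epsilon_trick _ _ (ltW e0)))//; last first.
  by move=> k; exact: hausdorff_pre_ge0.
pose P k (B : nat -> set 'rV[R]_n) := delta_cover delta (A k) B /\
  \sum_(j <oo) mu (B j) <= nu (A k) + (e / (2 ^ k.+1)%:R)%:E.
have [G PG] : {G : nat -> nat -> set 'rV[R]_n & forall k, P k (G k)}.
  apply: (@choice _ _ P) => k; rewrite /P.
  have fk : nu (A k) \is a fin_num.
    by rewrite ge0_fin_numE ?hausdorff_pre_ge0// ltey; apply/eqP/Aoo.
  have ek : (0 < e / (2 ^ k.+1)%:R)%R by rewrite divr_gt0// ltr0n expn_gt0.
  have [x [B dB <-] Bx] := lb_ereal_inf_adherent ek fk.
  by exists B; split => //; exact: ltW.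
apply: (@le_trans _ _ (\esum_(i in setT) (mu \o uncurry G) i)).
  apply: ereal_inf_lbound => /=.
  have /card_esym/ppcard_eqP[f] := card_nat2.
  exists (uncurry G \o f).
    split=> [i x y|t [i _ Ait]].
      by rewrite /= /uncurry; case: (f i) => a b; exact: (PG a).1.1.
    have [j _ Gijt] := (PG i).1.2 _ Ait.
    by exists (f^-1%FUN (i, j)) => //=; rewrite invK ?inE.
  rewrite -(esum_pred_image (mu \o uncurry G) _ xpredT) ?[fun=> _]set_true//.
    by rewrite image_eq.
  by move=> k _; exact: mu0.
rewrite (_ : esum _ _ = \sum_(i <oo) \sum_(j <oo) mu (G i j)); last first.
  pose J : nat -> set (nat * nat) := fun i => [set (i, j) | j in setT].
  rewrite (_ : setT = \bigcup_k J k); last first.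
    by rewrite predeqE => -[a b]; split => // _; exists a => //; exists b.
  rewrite esum_bigcupT /=; last 2 first.
  - apply/trivIsetP => i j _ _ ij.
    rewrite predeqE => -[k m] /=; split => //= -[] [_] _ [<-{k} _].
    by move=> [m' _] [] /esym/eqP; rewrite (negbTE ij).
  - by move=> [k m]; exact: mu0.
  rewrite -(image_id [set: nat]) -fun_true esum_pred_image//; last first.
    by move=> k _; apply: esum_ge0 => ? *; exact: mu0.
  apply: eq_eseriesr => /= j _.
  rewrite -(esum_pred_image (mu \o uncurry G) (pair j) predT)//=.
  - by congr esum; rewrite predeqE => -[a b]; split; move=> [i _ <-]; exists i.
  - by move=> ? ? _ _; exact: (@can_inj _ _ _ snd).
apply: lee_nneseries => [i _ _|i _]; last exact: (PG i).2.
by apply: nneseries_ge0 => j _ _; exact: mu0.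
Qed.

Lemma hausdorff0 d : hausdorff d set0 = 0.
Proof.
rewrite /hausdorff (_ : image _ _ = [set 0]) ?ereal_sup1//.
apply/seteqP; split=> [_ [delta _ <-]|_ ->]; first exact: hausdorff_pre0.
by exists 1%R => //=; exact: hausdorff_pre0.
Qed.

Lemma hausdorff_ge0 d A : 0 <= hausdorff d A.
Proof.
apply: (le_trans (hausdorff_pre_ge0 d 1%R A)).
by apply: ereal_sup_ubound; exists 1%R => /=.
Qed.

Lemma le_hausdorff d : {homo hausdorff d : A B / A `<=` B >-> A <= B}.
Proof.
move=> A B AB; apply: ge_ereal_sup => _ [delta d0 <-].
apply: (le_trans (le_hausdorff_pre d delta AB)).
by apply: ereal_sup_ubound; exists delta.
Qed.

Lemma hausdorff_sigma_subadditive d : sigma_subadditive (hausdorff d).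
Proof.
move=> A; apply: ge_ereal_sup => _ [delta d0 <-].
apply: (le_trans (hausdorff_pre_sigma_subadditive _ _ _)).
apply: lee_nneseries => [i _ _|i _]; first exact: hausdorff_pre_ge0.
by apply: ereal_sup_ubound; exists delta.
Qed.

HB.instance Definition _ d := isOuterMeasure.Build R 'rV[R]_n (hausdorff d)
  (hausdorff0 d) (hausdorff_ge0 d) (@le_hausdorff d)
  (@hausdorff_sigma_subadditive d).

End hausdorff.

(* Surface measure on hypersurfaces of R^n: the (n-1)-dimensional Hausdorff
   measure, on the sigma-algebra of its Caratheodory-measurable sets (which
   contains the Borel sets and all the null sets). *)
Section surface_measure.
Local Open Scope ereal_scope.
Variables (R : realType) (n : nat).

Definition surfaceType : measurableType _ :=
  caratheodory_type (@hausdorff R n n.-1).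

Definition surface_measure : set surfaceType -> \bar R := hausdorff n.-1.

Let surface_measure0 : surface_measure set0 = 0.
Proof. exact: hausdorff0. Qed.

Let surface_measure_ge0 A : 0 <= surface_measure A.
Proof. exact: hausdorff_ge0. Qed.

Let surface_measure_sigma_additive : semi_sigma_additive surface_measure.
Proof. exact: caratheodory_measure_sigma_additive. Qed.

HB.instance Definition _ := isMeasure.Build _ _ _ surface_measure
  surface_measure0 surface_measure_ge0 surface_measure_sigma_additive.

End surface_measure.
Arguments surface_measure : clear implicits.

Definition borelType (R : realType) (n : nat) :=
  g_sigma_algebraType (@open 'rV[R]_n).

Section discrete_measure.
Local Open Scope ereal_scope.
Context d (T : measurableType d) (R : realType) (k : nat).
Variables (a : 'I_k -> T) (g : 'I_k -> {nonneg R}).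

Definition discrete_measure (E : set T) : \bar R :=
  \sum_(i < k) (g i)%:num%:E * \d_(a i) E.

Let discrete_measure0 : discrete_measure set0 = 0.
Proof. by rewrite /discrete_measure big1// => i _; rewrite dirac0 mule0. Qed.

Let discrete_measure_ge0 E : 0 <= discrete_measure E.
Proof. by apply: sume_ge0 => i _; rewrite mule_ge0. Qed.

Let discrete_measure_sigma_additive : semi_sigma_additive discrete_measure.
Proof.
move=> F mF tF mUF; pose m i := mscale (g i) (\d_(a i) : {measure set T -> \bar R}).
rewrite [X in _ --> X](_ : _ =
    lim ((fun n => \sum_(0 <= i < n) discrete_measure (F i)) @ \oo)).
  by apply: is_cvg_ereal_nneg_natsum => j _; exact: discrete_measure_ge0.
rewrite nneseries_sum//; last by move=> i j _; rewrite mule_ge0.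
apply: eq_bigr => i _.
exact: (@measure_semi_bigcup _ _ _ (m i)).
Qed.

HB.instance Definition _ := isMeasure.Build _ _ _ discrete_measure
  discrete_measure0 discrete_measure_ge0 discrete_measure_sigma_additive.

End discrete_measure.

Section norms.
Context {R : realType} {n : nat}.
Implicit Types (N : 'rV[R]_n -> R) (S Omega : set 'rV[R]_n).

Definition is_norm N : Prop :=
  [/\ forall x y, N (x + y) <= N x + N y,
      forall (a : R) x, N (a *: x) = `|a| * N x &
      forall x, N x = 0 -> x = 0].

Definition unit_sphere N : set 'rV[R]_n := [set x | N x = 1].

Definition C1_away_from0 N : Prop :=
  forall x : 'rV[R]_n, x != 0 ->
    differentiable N x /\ {for x, continuous (grad N)}.

Definition contains_no_segment S : Prop :=
  forall x y : 'rV[R]_n, x != y ->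
    ~ ([set t *: x + (1 - t) *: y | t in `[0, 1]%classic] `<=` S).

(* [S] is closed in the uses below, so closures in S and in R^n coincide. *)
Definition closed_domain S Omega : Prop :=
  exists V : set 'rV[R]_n,
    [/\ open V, (V `&` S) !=set0, connected (V `&` S) &
        Omega = closure (V `&` S)].

Definition rel_boundary S Omega : set 'rV[R]_n :=
  S `&` closure Omega `&` closure (S `\` Omega).

End norms.

(* A surface {rho(x) x : x in Omega1} with rho > 0 is represented by its radial
   function rho, which it determines as Omega1 lies on a unit sphere; only the
   values of rho on Omega1 matter. *)
Section refractor.
Context {R : realType} {n : nat}.
Variables (N2 : 'rV[R]_n -> R) (Omega1 Omega2 : set 'rV[R]_n).
Implicit Types (rho f : 'rV[R]_n -> R) (b : R) (m x : 'rV[R]_n).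

Definition hfun b m x : R := b / (1 - dotp x (grad N2 m)).

Definition supports rho x0 m b : Prop :=
  (forall x, Omega1 x -> rho x <= hfun b m x) /\ rho x0 = hfun b m x0.

Definition is_refractor rho : Prop :=
  [/\ {within Omega1, continuous rho},
      forall x, Omega1 x -> 0 < rho x &
      forall x0, Omega1 x0 ->
        exists m b, [/\ Omega2 m, 0 < b & supports rho x0 m b]].

Definition refractor_map rho x0 : set 'rV[R]_n :=
  [set m | Omega2 m /\ exists2 b, 0 < b & supports rho x0 m b].

Definition refractor_preimage rho (E : set 'rV[R]_n) : set 'rV[R]_n :=
  [set x | Omega1 x /\ (refractor_map rho x `&` E) !=set0].

Definition refractor_measure rho f (E : set 'rV[R]_n) : \bar R :=
  (\int[surface_measure R n]_(x in refractor_preimage rho E) (f x)%:E)%E.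

Definition is_weak_solution f (mu : {measure set (borelType R n) -> \bar R})
    rho : Prop :=
  is_refractor rho /\
  forall E : set (borelType R n), measurable E -> E `<=` Omega2 ->
    refractor_measure rho f E = mu E.

Definition min_hfun k (b : 'I_k.+1 -> R) (m : 'I_k.+1 -> 'rV[R]_n) x : R :=
  \big[Num.min/hfun (b ord0) (m ord0) x]_(i < k.+1) hfun (b i) (m i) x.

End refractor.

(* Main.v *)
Require Import Defs.
From HB Require Import structures.
From mathcomp Require Import all_boot all_order all_algebra.
From mathcomp Require Import all_classical all_reals all_analysis.
From mathcomp Require Import measurable_realfun finmap ring lra.

(**
For i = 0, ..., k put w_i(x) = 1 - x . p_2(m_i), which lies in [1 - kappa, 2] on
Omega_1.  For positive b the refractor rho = min_i h_(b_i, m_i) splits Omega_1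
into the cells A_i(b) where b_i / w_i is the smallest of these quotients, and
the theorem reduces to a statement on cells, as follows.

A point x in the relative interior of Omega_1 that lies in A_i(b) and in no
other cell is refracted only to m_i.  Indeed if h_(c, y) touches rho from above
at x, then x . (c p_2(m_i) - b_i p_2(y)) has, on Sigma_1, a local maximum at x
with value c - b_i; by homogeneity c p_2(m_i) - b_i p_2(y) = (c - b_i) p_1(x),
and pairing this with y or with m_i, according to the sign of c - b_i, the
hypothesis m . p_1 >= 1 and the strict convexity of Sigma_2 give y = m_i
([contact_unique]).  The points left out are the relative boundary of Omega_1
and the interfaces A_i(b) n A_j(b).  An interface is contained in a hyperplane
section of Sigma_1, and such a section is null for surface measure
([sphere_section_null]): the dilations of the section with respect to a point
of the hyperplane inside the unit ball of N_1 are pairwise disjoint, at least as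
large as the section, and infinitely many of them fit in a bounded piece of the
hyperplane, which has finite measure (without a point of the hyperplane inside
the ball, the section has at most one point).  Hence the refractor measure of E is
sum_(m_i in E) nu(A_i(b)), where nu = f dx, and b solves the problem exactly when
nu(A_i(b)) = g_i for all i.

Existence.  Lowering b_i enlarges A_i(b) and shrinks the other cells.  Call b
admissible if b_0 is the prescribed number and nu(A_i(b)) <= g_i for i > 0.
Admissible families are bounded below, since the cell of index 0 cannot be
empty, and they are stable under coordinatewise minimum.  Their coordinatewise
infimum is admissible by continuity of nu from below, interfaces being null.  If
it had nu(A_i(b)) < g_i for some i > 0, then by continuity of nu from above b_i
could still be lowered; so equality holds for i > 0, and for i = 0 by the
balance condition ([least_admissible], [least_exact]).

Uniqueness.  Let b and c be solutions with b_i > c_i for some i, let r > 1 be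
the maximum of the b_i / c_i and I the set of indices where it is attained; the
index 0 is not in I.  The closed sets K = U_(i in I) A_i(b) and
L = U_(j not in I) A_j(c) are disjoint and of total nu-measure nu(Omega_1).  As
nonempty relatively open subsets of Omega_1 have positive measure
([sphere_open_gt0]), Omega_1 is the union of K and L, both nonempty, which
contradicts its connectedness ([cell_measures_inj_le]).

Surface measure enters through three facts on Hausdorff measure: it is additive
on separated sets, so that closed sets are measurable ([closed_caratheodory]); it
is finite on bounded pieces of hyperplanes, by covering with a grid of small
cubes ([hausdorff_coord_lty]); and it is positive on compact sets that
contain a copy of the d-cube under a map with Lipschitz inverse, by counting the
points of a fine grid in each member of a covering ([hausdorff_grid_gt0]).
*)

Set Implicit Arguments.
Unset Strict Implicit.
Unset Printing Implicit Defensive.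

Import Order.TTheory GRing.Theory Num.Theory.
Import numFieldNormedType.Exports.

Local Open Scope classical_set_scope.
Local Open Scope ring_scope.

(** * Closed sets are measurable for surface measure *)

Section metric_outer_measure.
Context {R : realType} {V : normedModType R}.
Variable mu : {outer_measure set V -> \bar R}.
Hypothesis mu_separated : forall (A B : set V) (e : R), 0 < e ->
  (forall x y, A x -> B y -> e <= `|x - y|) ->
  (mu A + mu B <= mu (A `|` B))%E.

Section far_pieces.
Variables C X : set V.

Definition far_part k : set V :=
  [set x | X x /\ forall y, C y -> k.+1%:R^-1 <= `|x - y|].

Definition far_shell k : set V := far_part k.+1 `\` far_part k.

(** Shells of indices at least two apart are separated: points of the inner one
are at distance at least 1/(i+2) from [C], points of the outer one at distance
less than 1/(j+1). *)
Lemma far_shell_separated i j x y : (i.+2 <= j)%N ->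
  far_shell i x -> far_shell j y ->
  j%:R^-1 - j.+1%:R^-1 <= `|x - y|.
Proof.
move=> ij [[Xx xC] _] [[Xy _] yC].
have [z [Cz zy]] : exists z, C z /\ `|y - z| < j.+1%:R^-1.
  apply: contrapT => nz; apply: yC; split => // z Cz.
  by rewrite leNgt; apply/negP => zy; apply: nz; exists z.
have xz := xC _ Cz.
have jR : (j%:R : R)^-1 <= i.+2%:R^-1.
  by rewrite lef_pV2 ?ler_nat// posrE ltr0n// (leq_trans _ ij).
rewrite lerBlDr (le_trans jR)// (le_trans xz)// (le_trans (ler_distD y x z))//.
by rewrite lerD2l ltW.
Qed.

(** Shells of the same parity are pairwise separated, so that the outer measure
adds up on them and the sum is controlled by the measure of [X]. *)
Lemma sum_far_shell_parity b n :
  (\sum_(i < n | odd i == b) mu (far_shell i) <= mu X)%E.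
Proof.
apply: (@le_trans _ _ (mu (\bigcup_(i in [set i | (i < n)%N /\ odd i = b]) far_shell i))).
  elim: n => [|n IH]; first by rewrite big_ord0 outer_measure_ge0.
  rewrite big_mkcond big_ord_recr/= -big_mkcond/=.
  have [oddn|_] := eqVneq (odd n) b; last first.
    rewrite adde0 (le_trans IH)//; apply: le_outer_measure => x [i [iltn ib] Di].
    by exists i => //; split => //; rewrite ltnS ltnW.
  apply: (le_trans (leeD2r _ IH)).
  have [n0|n0] := posnP n.
    rewrite n0 in oddn *; rewrite (_ : bigcup _ _ = set0); last first.
      by apply/seteqP; split => // x [i []].
    rewrite outer_measure0 add0e; apply: le_outer_measure => x Dx.
    by exists 0%N.
  apply: (@le_trans _ _ (mu ((\bigcup_(i in [set i | (i < n)%N /\ odd i = b]) far_shell i)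
     `|` far_shell n))); last first.
    apply: le_outer_measure => x [[i [iltn ib] Di]|Dn].
      by exists i => //; split => //; rewrite ltnS ltnW.
    by exists n => //; split.
  apply: (@mu_separated _ _ (n%:R^-1 - n.+1%:R^-1)).
    by rewrite subr_gt0 ltf_pV2 ?posrE ?ltr0n// ltr_nat.
  move=> x y [i [iltn ib] Di] Dn; apply: far_shell_separated Di Dn.
  rewrite ltn_neqAle iltn andbT; apply/eqP => iE.
  by move: oddn; rewrite -iE -ib /=; case: (odd i).
by apply: le_outer_measure => x [i _ [[]]].
Qed.

Lemma sum_far_shell n : (\sum_(i < n) mu (far_shell i) <= mu X + mu X)%E.
Proof.
rewrite (bigID (fun i : 'I_n => odd i == true))/=; apply: leeD.
  exact: sum_far_shell_parity.
rewrite (eq_bigl (fun i : 'I_n => odd i == false)); last by move=> i; case: odd.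
exact: sum_far_shell_parity.
Qed.

(** This is where closedness is used: a point outside [C] is at positive distance
from [C], hence in some [far_part]. *)
Lemma far_cover k : closed C ->
  X `\` C `<=` far_part k `|` \bigcup_(i in ~` `I_k) far_shell i.
Proof.
move=> clC x [Xx nCx].
have [n far_n] : exists n, far_part n x.
  have : nbhs x (~` C) by apply: open_nbhs_nbhs; split => //; exact: closed_openC.
  move=> /nbhs_normP[e /= e0 xe].
  have [n _ nP] := near_infty_natSinv_lt (PosNum e0).
  exists n; split => // y Cy; rewrite leNgt; apply/negP => xy.
  by apply: (xe y) => //=; rewrite (lt_trans xy)//; exact: (nP n (leqnn n)).
have [/asboolP kx|/asboolPn nkx] := boolP `[< far_part k x >]; first by left.
right; have nk : (k < n)%N.
  rewrite ltnNge; apply/negP => nk; apply: nkx; split => // y Cy.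
  apply: le_trans (far_n.2 _ Cy).
  by rewrite lef_pV2 ?posrE ?ltr0n// ler_nat ltnS.
(* the shell containing x ends at the least such index *)
have P : exists n, `[< far_part n x >] by exists n; apply/asboolP.
case: (ex_minnP P) => -[|i] /asboolP xi imin.
  exfalso; apply: nkx; split => // y Cy.
  apply: le_trans (xi.2 _ Cy).
  by rewrite lef_pV2 ?posrE ?ltr0n// ler_nat ltnS.
have nxi : ~ far_part i x.
  by move=> /asboolP /imin; rewrite ltnn.
exists i => //=; apply/negP; rewrite -leqNgt leqNgt; apply/negP => ik.
apply: nkx; split => // y Cy.
apply: le_trans (xi.2 _ Cy).
by rewrite lef_pV2 ?posrE ?ltr0n// ler_nat ltnS.
Qed.

End far_pieces.

(** Caratheodory's criterion for metric outer measures.  Splitting [X] into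
[X `&` C] and the part of [X] at distance at least 1/(k+1) from [C] loses only
the shells of index at least [k], whose total measure tends to 0. *)
Lemma closed_caratheodory (C : set V) : closed C -> mu.-caratheodory C.
Proof.
move=> clC; apply: le_caratheodory_measurable => X.
have [Xoo|Xfin] := eqVneq (mu X) +oo%E; first by rewrite Xoo leey.
have XltT : (mu X < +oo)%E by rewrite ltey.
have tail : (\sum_(k <= i <oo) mu (far_shell C X i))%E @[k --> \oo] --> 0%E.
  apply: nneseries_tail_cvg => [|i _]; last exact: outer_measure_ge0.
  apply: (@le_lt_trans _ _ (mu X + mu X)%E); last by rewrite lte_add_pinfty.
  apply: lime_le; first by apply: is_cvg_nneseries => i _ _; exact: outer_measure_ge0.
  by near=> n; rewrite big_mkord; exact: sum_far_shell.
apply/lee_addgt0Pr => e e0.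
have : \forall k \near \oo, (\sum_(k <= i <oo) mu (far_shell C X i) < e%:E)%E.
  by apply: (tail (fun u => u < e%:E)%E); apply: open_ereal_lt'; rewrite lte_fin.
move=> [k _ /(_ k (leqnn k)) ke].
have -> : X `&` ~` C = X `\` C by [].
apply: (@le_trans _ _ (mu (X `&` C) + (mu (far_part C X k) + e%:E))%E).
  rewrite leeD2l//.
  apply: le_trans (le_outer_measure mu _ _ (@far_cover C X k clC)) _.
  apply: le_trans (outer_measureU2 mu _ _) _; rewrite leeD2l//.
  exact: le_trans (outer_measure_sigma_subadditive_tail mu k _) (ltW ke).
rewrite addeA leeD2r//.
have sep : forall x y, (X `&` C) x -> far_part C X k y -> k.+1%:R^-1 <= `|x - y|.
  by move=> x y [_ Cx] [_ yC]; rewrite distrC; exact: yC.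
apply: le_trans (mu_separated _ sep) _; first by rewrite invr_gt0 ltr0n.
by apply: le_outer_measure => x [[]|[]].
Unshelve. all: by end_near. Qed.

End metric_outer_measure.

Section euclidean_norm.
Context {R : realType} {n : nat}.
Implicit Types x y : 'rV[R]_n.

Lemma dotp_ge0 x : 0 <= dotp x x.
Proof. by apply: sumr_ge0 => i _; rewrite -expr2 sqr_ge0. Qed.

Lemma coord_le_norm x i : `|x ord0 i| <= `|x|.
Proof.
rewrite [leRHS]mx_normrE.
exact: (le_bigmax _ (fun ij : 'I_1 * 'I_n => `|x ij.1 ij.2|) (ord0, i)).
Qed.

Lemma norm_le_coord x (e : R) : 0 <= e -> (forall i, `|x ord0 i| <= e) -> `|x| <= e.
Proof.
move=> e0 xe; rewrite [leLHS]mx_normrE; apply: bigmax_le => // -[i j] _ /=.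
by rewrite ord1.
Qed.

(** The norm [`|x|] of a row vector is its sup norm; distances and Lipschitz
constants are measured with it below, and this lemma and the next one transfer
the bounds to the Euclidean diameters entering Hausdorff measure. *)
Lemma norm_le_enorm x : `|x| <= enorm x.
Proof.
apply: norm_le_coord => [|i]; first exact: sqrtr_ge0.
rewrite -sqrtr_sqr ler_sqrt ?dotp_ge0// /dotp (bigD1 i)//= expr2 lerDl.
by apply: sumr_ge0 => j _; rewrite -expr2 sqr_ge0.
Qed.

Lemma enorm_le_norm x : enorm x <= n%:R * `|x|.
Proof.
have nx0 : 0 <= n%:R * `|x| by rewrite mulr_ge0.
rewrite -[leRHS]ger0_norm// -sqrtr_sqr ler_sqrt ?sqr_ge0//.
apply: (@le_trans _ _ (\sum_(i < n) `|x| ^+ 2)).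
  apply: ler_sum => i _; rewrite -expr2 -real_normK ?num_real//.
  by rewrite lerXn2r ?nnegrE// coord_le_norm.
rewrite sumr_const card_ord exprMn -[leLHS]mulr_natl.
rewrite ler_wpM2r ?sqr_ge0//.
by rewrite -natrX ler_nat; case: (n) => // d; rewrite leq_pmull//.
Qed.

End euclidean_norm.

Section hausdorff_metric.
Context {R : realType} {n : nat}.
Local Open Scope ereal_scope.
Variable d : nat.
Implicit Types A B : set 'rV[R]_n.

Lemma hausdorff_pre_antitone (r s : R) A : (r <= s)%R ->
  hausdorff_pre d s A <= hausdorff_pre d r A.
Proof.
move=> rs; apply: ereal_inf_le_tmp => _ [U [Ur AU] <-].
by exists U => //; split => // k x y Ux Uy; exact: le_trans (Ur k x y Ux Uy) rs.
Qed.

(** A set of diameter less than the distance of [A] and [B] meets at most one of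
them, so a covering of the union splits into coverings of [A] and of [B]. *)
Lemma hausdorff_pre_separated (r e : R) A B : (r < e)%R ->
  (forall x y, A x -> B y -> (e <= `|x - y|)%R) ->
  hausdorff_pre d r A + hausdorff_pre d r B <= hausdorff_pre d r (A `|` B).
Proof.
move=> re sep; apply: le_ereal_inf_tmp => _ [U [Ur ABU] <-].
pose part C k := if `[< U k `&` C !=set0 >] then U k else set0.
have part_cover C : C `<=` A `|` B -> delta_cover r C (part C).
  move=> CAB; split=> [k x y|x Cx].
    by rewrite /part; case: asboolP => // _; exact: Ur.
  have [k _ Ukx] := ABU _ (CAB _ Cx); exists k => //.
  by rewrite /part asboolT//; exists x.
have w0 := @hausdorff_weight_ge0 R n d.
apply: (@le_trans _ _ (\sum_(k <oo) (hausdorff_weight d (part A k) +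
                                     hausdorff_weight d (part B k)))).
  rewrite nneseriesD//; apply: leeD; apply: ereal_inf_lbound.
    by exists (part A) => //; apply: part_cover => x; left.
  by exists (part B) => //; apply: part_cover => x; right.
have wset0 : hausdorff_weight d (set0 : set 'rV[R]_n) = 0.
  by rewrite /hausdorff_weight asboolT.
apply: lee_nneseries => [k _ _|k _]; first by rewrite adde_ge0.
rewrite /part; case: asboolP => [[x [Ux Ax]]|_]; last first.
  by rewrite wset0 add0e; case: asboolP; rewrite ?wset0.
case: asboolP => [[y [Uy By]]|_]; last by rewrite wset0 adde0.
have := le_trans (sep _ _ Ax By) (le_trans (norm_le_enorm _) (Ur k x y Ux Uy)).
by rewrite leNgt re.
Qed.

Lemma hausdorff_separated A B (e : R) : (0 < e)%R ->
  (forall x y, A x -> B y -> (e <= `|x - y|)%R) ->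
  hausdorff d A + hausdorff d B <= hausdorff d (A `|` B).
Proof.
move=> e0 sep; have [->|ABfin] := eqVneq (hausdorff d (A `|` B)) +oo.
  exact: leey.
have Bfin : hausdorff d B \is a fin_num.
  rewrite ge0_fin_numE ?hausdorff_ge0//.
  by rewrite (le_lt_trans (@le_hausdorff _ _ d B (A `|` B) _)) ?ltey// => x; right.
rewrite -leeBrDr//; apply: ge_ereal_sup => _ [r /= r0 <-].
rewrite leeBrDr// addeC.
have pAfin : hausdorff_pre d r A \is a fin_num.
  rewrite ge0_fin_numE ?hausdorff_pre_ge0//.
  apply: (@le_lt_trans _ _ (hausdorff d A)).
    by apply: ereal_sup_ubound; exists r.
  by rewrite (le_lt_trans (@le_hausdorff _ _ d A (A `|` B) _)) ?ltey// => x; left.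
rewrite -leeBrDr//; apply: ge_ereal_sup => _ [s /= s0 <-].
rewrite leeBrDr// addeC.
pose t : R := (Num.min (Num.min r s) (e / 2))%R.
have t0 : (0 < t)%R by rewrite !lt_min r0 s0 divr_gt0.
have tr : (t <= r)%R by rewrite !ge_min lexx.
have ts : (t <= s)%R by rewrite !ge_min lexx orbT.
have te : (t < e)%R by rewrite gt_min [X in _ || X]ltr_pdivrMr// ltr_pMr// ltr1n orbT.
apply: le_trans (leeD (hausdorff_pre_antitone _ tr) (hausdorff_pre_antitone _ ts)) _.
apply: le_trans (hausdorff_pre_separated te sep) _.
by apply: ereal_sup_ubound; exists t.
Qed.

End hausdorff_metric.

Lemma closed_surface_measurable (R : realType) (n : nat) (C : set 'rV[R]_n) :
  closed C -> measurable (C : set (surfaceType R n)).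
Proof.
move=> clC.
pose mu : {outer_measure set 'rV[R]_n -> \bar R} := hausdorff n.-1.
apply: (closed_caratheodory (mu := mu)) clC => A B e.
exact: hausdorff_separated.
Qed.

(** * Upper and lower estimates of Hausdorff measure *)

Section hausdorff_upper.
Context {R : realType} {n : nat}.
Variable d : nat.
Implicit Types A U : set 'rV[R]_n.

Lemma hausdorff_pre_finite_cover (I : finType) (U : I -> set 'rV[R]_n) A (r : R) :
  (forall i x y, U i x -> U i y -> enorm (x - y) <= r) ->
  A `<=` \bigcup_i U i ->
  (hausdorff_pre d r A <= \sum_i hausdorff_weight d (U i))%E.
Proof.
move=> Ur AU.
pose V k := if insub k is Some i then U (enum_val (i : 'I_#|I|)) else set0.
have VE (i : 'I_#|I|) : V i = U (enum_val i) by rewrite /V valK.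
have V0 k : (#|I| <= k)%N -> V k = set0.
  by move=> Ik; rewrite /V insubF// ltnNge Ik.
apply: (@le_trans _ _ (\sum_(k <oo) hausdorff_weight d (V k))%E).
  apply: ereal_inf_lbound; exists V => //; split=> [k x y|x Ax].
    by rewrite /V; case: insub => // i; exact: Ur.
  have [i _ Uix] := AU _ Ax; exists (enum_rank i) => //.
  by rewrite VE enum_rankK.
rewrite (nneseries_split _ #|I|); last by move=> k _; exact: hausdorff_weight_ge0.
rewrite [X in (_ + X)%E]eseries0; last first.
  by move=> k Ik _; rewrite V0// /hausdorff_weight asboolT.
rewrite adde0 big_mkord [leRHS](reindex _ (onW_bij _ (enum_val_bij I)))/=.
by apply: lee_sum => i _; rewrite VE.
Qed.

Lemma ediam_le U (r : R) : 0 <= r ->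
  (forall x y, U x -> U y -> enorm (x - y) <= r) -> ediam U <= r.
Proof.
move=> r0 Ur; rewrite /ediam; set D := (X in sup X).
have [D0|D0] := pselect (D !=set0); last first.
  rewrite (_ : D = set0) ?sup0//.
  by apply/seteqP; split => // x Dx; exfalso; apply: D0; exists x.
by apply: ge_sup => // _ [[x y] [/= Ux Uy] <-]; exact: Ur.
Qed.

(** Finiteness by a grid: if [d] coordinates with values in [0, 1[ control
distances in [A], the [M ^ d] cells of side [1 / M] in these coordinates have
diameter at most [L / M], and the sum of their weights does not depend on [M]. *)
Lemma hausdorff_coord_lty A (pi_ : 'rV[R]_n -> 'I_d -> R) (L : R) : 0 <= L ->
  (forall x j, A x -> 0 <= pi_ x j < 1) ->
  (forall x y (e : R), A x -> A y -> 0 <= e ->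
     (forall j, `|pi_ x j - pi_ y j| <= e) -> enorm (x - y) <= L * e) ->
  (hausdorff d A < +oo)%E.
Proof.
move=> L0 Api AL.
have w0 : 0 <= @unit_ball_volume R d by exact: unit_ball_volume_ge0.
apply: (@le_lt_trans _ _ (unit_ball_volume d * (L / 2) ^+ d)%:E); last exact: ltry.
apply: ge_ereal_sup => _ [r /= r0 <-].
pose M := (Num.truncn (L / r)).+1.
have M0 : 0 < M%:R :> R by rewrite ltr0n.
have LMr : L / M%:R <= r.
  by rewrite ler_pdivrMr// mulrC -ler_pdivrMr// ltW// truncnS_gt.
pose U (a : {ffun 'I_d -> 'I_M}) : set 'rV[R]_n :=
  [set x | A x /\ forall j, (a j)%:R <= M%:R * pi_ x j < (a j).+1%:R].
have UL a x y : U a x -> U a y -> enorm (x - y) <= L / M%:R.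
  move=> [Ax ax] [Ay ay]; apply: AL => // j.
  rewrite -(ler_pM2l M0) mulfV ?gt_eqF// -[X in X * _]gtr0_norm// -normrM mulrBr.
  have /andP[] := ax j; have /andP[] := ay j.
  rewrite -!natr1 => *; rewrite ler_norml; apply/andP; split; lra.
apply: (@le_trans _ _ (\sum_a hausdorff_weight d (U a))%E).
  apply: hausdorff_pre_finite_cover => [a x y Ux Uy|x Ax].
    exact: le_trans (UL a x y Ux Uy) LMr.
  have tr j : (Num.truncn (M%:R * pi_ x j) < M)%N.
    have /andP[p0 p1] := Api x j Ax.
    by rewrite truncn_lt_nat ?mulr_ge0// gtr_pMr.
  exists [ffun j => Ordinal (tr j)] => //; split => // j; rewrite ffunE /=.
  by apply: truncn_itv; have /andP[p0 p1] := Api x j Ax; rewrite mulr_ge0.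
apply: (@le_trans _ _ (\sum_(a : {ffun 'I_d -> 'I_M})
    (unit_ball_volume d * (L / M%:R / 2) ^+ d)%:E)%E).
  apply: lee_sum => a _; rewrite /hausdorff_weight.
  have LM0 : 0 <= L / M%:R by rewrite divr_ge0.
  case: ifP => _; first by rewrite lee_fin mulr_ge0// exprn_ge0// divr_ge0.
  rewrite lee_fin ler_wpM2l// lerXn2r ?nnegrE ?divr_ge0 ?ediam_ge0//.
  by rewrite ler_pM2r ?invr_gt0//; apply: ediam_le => // x y; exact: UL.
rewrite sumEFin sumr_const card_ffun !card_ord lee_fin -mulrnAr ler_wpM2l//.
rewrite -[leLHS]mulr_natr natrX -exprMn.
by rewrite (_ : L / M%:R / 2 * M%:R = L / 2)//; field; rewrite gt_eqF.
Qed.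

End hausdorff_upper.

Section hausdorff_lower.
Context {R : realType} {n : nat}.

Lemma unit_ball_volume_gt0 d : 0 < @unit_ball_volume R d.
Proof.
suff : 0 < @unit_ball_volume R d /\ 0 < @unit_ball_volume R d.+1 by case.
elim: d => [|d [IH1 IH2]]; first by split.
by split=> //=; rewrite mulr_gt0// divr_gt0// mulr_gt0// pi_gt0.
Qed.

(** Points of an integer grid whose coordinates differ pairwise by at most [s]
lie in a box of side [s]; the corner is found as the minimum of each coordinate. *)
Lemma card_grid_le (d M s : nat) (X : {set {ffun 'I_d -> 'I_M}}) :
  (forall a b j, a \in X -> b \in X -> (a j <= b j + s)%N) ->
  (#|X| <= s.+1 ^ d)%N.
Proof.
move=> Xs; have [->|[a0 a0X]] := set_0Vmem X; first by rewrite cards0.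
pose c j : nat := [arg min_(a < a0 in X) (a j : nat)] j.
have cP j : (exists2 a, a \in X & c j = a j) /\ forall a, a \in X -> (c j <= a j)%N.
  by rewrite /c; case: arg_minnP => // a aX amin; split; [exists a|].
pose h (a : {ffun 'I_d -> 'I_M}) : {ffun 'I_d -> 'I_s.+1} :=
  [ffun j => inord (a j - c j)].
have hE a j : a \in X -> (h a j = a j - c j :> nat)%N.
  move=> aX; rewrite ffunE inordK// ltnS leq_subLR.
  by have [[b bX ->] _] := cP j; exact: Xs.
rewrite -(card_in_imset (f := h)); last first.
  move=> a b aX bX hab; apply/ffunP => j; apply/val_inj => /=.
  have := congr1 (fun f : {ffun 'I_d -> 'I_s.+1} => nat_of_ord (f j)) hab.
  rewrite /= !hE// => /eqP; rewrite -(eqn_add2r (c j)).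
  by rewrite !subnK ?(cP j).2// => /eqP.
by rewrite (leq_trans (max_card _))// card_ffun !card_ord.
Qed.

End hausdorff_lower.

(** Positivity without Lebesgue measure.  Slightly enlarge a covering of [C] to
an open one and extract a finite subcovering.  A member of diameter [r] contains
the images of at most [(M * (L + 1) * r) ^ d] of the [M ^ d] points of the grid
of step [1 / M], once [M * r >= 1]; as all points are covered, the sum of the
[r ^ d] is at least [(L + 1) ^ - d]. *)
Lemma hausdorff_grid_gt0 (R : realType) (n d : nat) (C : set 'rV[R]_n)
    (phi : ('I_d -> R) -> 'rV[R]_n) (L : R) : 0 <= L -> compact C ->
  (forall t, (forall j, 0 <= t j <= 1) -> C (phi t)) ->
  (forall t s, (forall j, 0 <= t j <= 1) -> (forall j, 0 <= s j <= 1) ->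
     forall j, `|t j - s j| <= L * `|phi t - phi s|) ->
  (0 < hausdorff d C)%E.
Proof.
move=> L0 cC Cphi phiL.
set w : R := unit_ball_volume d.
pose c : R := w / 2 ^+ d.
have c0 : 0 < c by rewrite divr_gt0 ?exprn_gt0 ?unit_ball_volume_gt0.
pose K : R := L + 1.
have K0 : 0 < K by rewrite ltr_wpDl.
apply: (@lt_le_trans _ _ (c / K ^+ d)%:E); first by rewrite lte_fin divr_gt0// exprn_gt0.
apply: (@le_trans _ _ (hausdorff_pre d 1 C)); last first.
  by apply: ereal_sup_ubound; exists 1 => /=.
apply: le_ereal_inf_tmp => _ [U [U1 CU] <-].
apply/lee_addgt0Pr => e e0.
apply: le_trans (epsilon_trick xpredT _ (ltW e0)); last first.
  by move=> k; exact: hausdorff_weight_ge0.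
pose ek k : R := e / (2 ^ k.+1)%:R.
have ek0 k : 0 < ek k by rewrite divr_gt0// ltr0n expn_gt0.
(* eta k is small enough for the enlargement of U k to cost at most ek k *)
have [eta etaP] : {eta : nat -> R & forall k, 0 < eta k /\
    c * (ediam (U k) + 2 * eta k) ^+ d <= c * ediam (U k) ^+ d + ek k}.
  apply: (@choice _ _ (fun k (h : R) => 0 < h /\
    c * (ediam (U k) + 2 * h) ^+ d <= c * ediam (U k) ^+ d + ek k)) => k.
  pose q (h : R) : R := c * (ediam (U k) + 2 * h) ^+ d.
  have qc : {for 0, continuous q}.
    apply: continuousM; first exact: cst_continuous.
    apply: (@continuous_comp _ _ _ (fun h : R => ediam (U k) + 2 * h) (fun u : R => u ^+ d));
      last exact: exprn_continuous.
    apply: continuousD; first exact: cst_continuous.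
    by apply: continuousM; [exact: cst_continuous|exact: cvg_id].
  have : \forall h \near 0, `|q 0 - q h| < ek k.
    by have /cvgr_dist_lt := qc; apply.
  move=> /nbhs_normP[r /= r0 qr].
  exists (r / 2); split; first exact: divr_gt0.
  have /qr : ball_ Num.norm 0 r (r / 2).
    by rewrite /= sub0r normrN gtr0_norm ?divr_gt0// ltr_pdivrMr// ltr_pMr// ltr1n.
  by rewrite /= ltr_distlC /q mulr0 addr0 => /andP[_ /ltW].
pose V k : set 'rV[R]_n := \bigcup_(x in U k) ball x (eta k).
have [D _ CD] : finite_subset_cover setT V C.
  have := cC; rewrite compact_cover; apply.
    move=> k _; apply: (@bigcup_open _ _ (U k) (fun x => ball x (eta k))) => x _.
    exact: ball_open.
  move=> x /CU[k _ Ux]; exists k => //; exists x => //.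
  exact: ballxx (etaP k).1.
pose r k : R := ediam (U k) + 2 * eta k.
have r0 k : 0 < r k.
  by rewrite ltr_wpDl ?ediam_ge0// mulr_gt0// (etaP k).1.
have Vr k x y : V k x -> V k y -> `|x - y| <= r k.
  move=> [x' Ux' xx'] [y' Uy' yy'].
  have xy' : `|x' - y'| <= ediam (U k).
    apply: le_trans (norm_le_enorm _) _.
    apply: ub_le_sup; last by exists (x', y').
    by exists 1 => _ [[a b] [/= Ua Ub] <-]; exact: U1 Ua Ub.
  move: xx' yy'; rewrite -!ball_normE /= => xx' yy'.
  rewrite (le_trans (ler_distD x' x y))// (le_trans (lerD (lexx _) (ler_distD y' x' y)))//.
  rewrite distrC /r; move: xx' yy' xy'.
  by move: `|_| `|_| `|_| (eta k) (ediam _) => *; lra.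
pose N := (\max_(k <- D) k).+1.
have DN k : k \in D -> (k < N)%N.
  by move=> kD; rewrite ltnS; exact: leq_bigmax_seq.
(* a step finer than every diameter r k, as each term of the sum is at least 1 / r k *)
pose M := (\sum_(k < N) (Num.truncn (r k)^-1).+1)%N.
have M0 : (0 < M)%N by rewrite /M big_ord_recl.
have Mr k : (k < N)%N -> 1 <= M%:R * r k.
  move=> kN; rewrite -ler_pdivrMr// div1r ltW// (lt_le_trans (truncnS_gt _))//.
  by rewrite ler_nat /M (bigD1 (Ordinal kN))//= leq_addr.
have MR0 : 0 < M%:R :> R by rewrite ltr0n.
pose grid (a : {ffun 'I_d -> 'I_M}) (j : 'I_d) : R := (a j)%:R / M%:R.
have grid01 a j : 0 <= grid a j <= 1.
  by rewrite divr_ge0//= ler_pdivrMr// mul1r ler_nat ltnW.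
pose X k : {set {ffun 'I_d -> 'I_M}} := [set a | `[< V k (phi (grid a)) >]]%SET.
(* empty members of the covering have weight 0 and contain no grid point *)
have XM k : (k < N)%N -> c * #|X k|%:R <=
    (M%:R * K) ^+ d * fine (hausdorff_weight d (U k) + (ek k)%:E)%E.
  move=> kN; have [Uk0|Uk0] := pselect (U k = set0).
    rewrite (_ : X k = finset.set0) ?cards0 ?mulr0.
      rewrite mulr_ge0// ?exprn_ge0 ?mulr_ge0 ?(ltW K0)//.
      by rewrite fine_ge0// adde_ge0 ?hausdorff_weight_ge0// lee_fin ltW.
    apply/setP => a; rewrite !inE; apply/negbTE/asboolPn.
    by rewrite /V Uk0 bigcup_set0.
  have -> : fine (hausdorff_weight d (U k) + (ek k)%:E)%E
      = c * ediam (U k) ^+ d + ek k.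
    rewrite /hausdorff_weight asboolF//= -/w [(_ / 2) ^+ d]exprMn exprVn /c.
    by congr (_ + _); rewrite mulrCA mulrC.
  apply: (@le_trans _ _ (c * (M%:R * K * r k) ^+ d)); last first.
    rewrite [(_ * r k) ^+ d]exprMn mulrCA ler_wpM2l ?(etaP k).2//.
    by rewrite exprn_ge0// mulr_ge0// ltW.
  rewrite ler_pM2l//.
  pose s := Num.truncn (M%:R * L * r k).
  have s0 : 0 <= M%:R * L * r k by rewrite mulr_ge0 ?mulr_ge0 ?(ltW (r0 k)).
  have /andP[sle _] := truncn_itv s0.
  apply: (@le_trans _ _ ((s.+1)%:R ^+ d)).
    rewrite -natrX ler_nat; apply: card_grid_le => a b j; rewrite !inE.
    move=> /asboolP Va /asboolP Vb.
    rewrite -leq_subLR truncn_ge_nat//.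
    have [ab|/ltnW ba] := leqP (a j) (b j).
      by move: (ab); rewrite -subn_eq0 => /eqP ->.
    rewrite natrB// -mulrA -ler_pdivrMl// mulrC mulrBl.
    apply: le_trans (ler_norm _) _.
    apply: le_trans (phiL (grid a) (grid b) (grid01 a) (grid01 b) j) _.
    by rewrite ler_wpM2l//; exact: Vr.
  rewrite lerXn2r ?nnegrE// ?mulr_ge0 ?(ltW K0) ?(ltW (r0 k))//.
  have := Mr _ kN; rewrite -natr1 /K; move: sle; rewrite -/s; nra.
rewrite (@le_trans _ _ (\sum_(0 <= k < N) (hausdorff_weight d (U k) + (ek k)%:E))%E)//; last first.
  apply: nneseries_lim_ge => k _ _.
  by rewrite adde_ge0 ?hausdorff_weight_ge0// lee_fin ltW.
have wfin k : (hausdorff_weight d (U k) + (ek k)%:E)%E \is a fin_num.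
  by rewrite fin_numD/= andbT /hausdorff_weight; case: ifP.
rewrite (eq_bigr (fun k => (fine (hausdorff_weight d (U k) + (ek k)%:E))%:E)); last first.
  by move=> k _; rewrite fineK.
rewrite sumEFin lee_fin.
have MK0 : 0 < (M%:R * K) ^+ d by rewrite exprn_gt0// mulr_gt0.
rewrite -(ler_pM2l MK0) exprMn mulrACA [_ * c]mulrC -mulrA mulfV ?mulr1; last first.
  by rewrite gt_eqF// exprn_gt0.
have -> : c * M%:R ^+ d = c * #|{ffun 'I_d -> 'I_M}|%:R.
  by rewrite card_ffun !card_ord natrX.
rewrite -exprMn mulr_sumr.
apply: (@le_trans _ _ (\sum_(0 <= k < N) c * #|X k|%:R)); last first.
  by apply: ler_sum_nat => k /andP[_ kN]; exact: XM.
rewrite -mulr_sumr ler_pM2l// -natr_sum ler_nat -sum1_card.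
under [leqRHS]eq_bigr do rewrite -sum1_card.
rewrite (exchange_big_dep xpredT)//=.
apply: leq_sum => a _.
have [k kD Vk] := CD _ (Cphi _ (grid01 a)).
rewrite big_mkcond/= big_mkord (bigD1 (Ordinal (DN _ kD)))//=.
by rewrite inE asboolT.
Qed.

(** * Norms, their gradients and strict convexity *)

Lemma lipschitz_continuous {R : realType} {V : normedModType R} (f : V -> R) (K : R) :
  (forall x y, `|f x - f y| <= K * `|x - y|) -> continuous f.
Proof.
move=> fK x; apply/cvgrPdist_lt => e e0.
have K1 : 0 < `|K| + 1 by rewrite ltr_wpDl.
near=> y.
apply: le_lt_trans (fK x y) _.
apply: (@le_lt_trans _ _ ((`|K| + 1) * `|x - y|)).
  by rewrite ler_wpM2r// (le_trans (ler_norm _))// lerDl.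
rewrite -ltr_pdivlMl//; near: y; apply/nbhs_normP.
by exists ((`|K| + 1)^-1 * e) => //=; rewrite mulr_gt0 ?invr_gt0.
Unshelve. all: by end_near. Qed.

Section dot_product.
Context {R : realType} {n : nat}.
Implicit Types (x y p q : 'rV[R]_n) (a : R).

Lemma dotpC x y : dotp x y = dotp y x.
Proof. by apply: eq_bigr => i _; rewrite mulrC. Qed.

Lemma dotpDl x y q : dotp (x + y) q = dotp x q + dotp y q.
Proof. by rewrite -big_split; apply: eq_bigr => i _; rewrite mxE mulrDl. Qed.

Lemma dotpZl a x q : dotp (a *: x) q = a * dotp x q.
Proof. by rewrite /dotp mulr_sumr; apply: eq_bigr => i _; rewrite mxE mulrA. Qed.

Lemma dotpBl x y q : dotp (x - y) q = dotp x q - dotp y q.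
Proof. by rewrite dotpDl -scaleN1r dotpZl mulN1r. Qed.

Lemma dotpBr x p q : dotp x (p - q) = dotp x p - dotp x q.
Proof. by rewrite !(dotpC x) dotpBl. Qed.

Lemma dotpZr a x q : dotp x (a *: q) = a * dotp x q.
Proof. by rewrite !(dotpC x) dotpZl. Qed.

Lemma dotp_continuous q : continuous (fun x => dotp x q).
Proof.
apply: (@lipschitz_continuous _ _ _ (\sum_i `|q ord0 i|)) => x y.
rewrite -dotpBl /dotp mulr_suml (le_trans (ler_norm_sum _ _ _))//.
by apply: ler_sum => i _; rewrite normrM mulrC ler_wpM2l// coord_le_norm.
Qed.

End dot_product.

Section norm_facts.
Context {R : realType} {n : nat}.
Variable N : 'rV[R]_n -> R.
Hypothesis normN : is_norm N.
Implicit Types x y v : 'rV[R]_n.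

Let ND : forall x y, N (x + y) <= N x + N y. Proof. by case: normN. Qed.
Let NZ : forall (a : R) x, N (a *: x) = `|a| * N x. Proof. by case: normN. Qed.

Lemma is_norm0 : N 0 = 0.
Proof. by rewrite -[0 in LHS](scale0r 0) NZ normr0 mul0r. Qed.

Lemma is_normN x : N (- x) = N x.
Proof. by rewrite -scaleN1r NZ normrN1 mul1r. Qed.

Lemma is_norm_ge0 x : 0 <= N x.
Proof. by have := ND x (- x); rewrite subrr is_norm0 is_normN; lra. Qed.

Lemma is_norm_sub x y : N x - N y <= N (x - y).
Proof. by rewrite lerBlDr -[x in leLHS](subrK y) ND. Qed.

Lemma is_norm_dist x y : `|N x - N y| <= N (x - y).
Proof.
rewrite ler_norml is_norm_sub andbT.
by have := is_norm_sub y x; rewrite -(opprB x y) is_normN; lra.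
Qed.

Lemma is_norm_le x : N x <= (\sum_(i < n) N (delta_mx ord0 i)) * `|x|.
Proof.
have NS I (r : seq I) (F : I -> 'rV[R]_n) : N (\sum_(i <- r) F i) <= \sum_(i <- r) N (F i).
  elim/big_rec2: _ => [|i u w _ IH]; first by rewrite is_norm0.
  by rewrite (le_trans (ND _ _))// lerD2l.
rewrite [x in N x]row_sum_delta (le_trans (NS _ _ _))// mulr_suml.
by apply: ler_sum => i _; rewrite NZ mulrC ler_wpM2l ?is_norm_ge0// coord_le_norm.
Qed.

Lemma is_norm_continuous : continuous N.
Proof.
apply: (@lipschitz_continuous _ _ N (\sum_(i < n) N (delta_mx ord0 i))) => x y.
by apply: le_trans (is_norm_dist x y) (is_norm_le _).
Qed.

Lemma unit_sphere_closed : closed (unit_sphere N).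
Proof.
rewrite (_ : unit_sphere N = N @^-1` [set 1])//.
apply: (@closed_comp _ _ N); last exact: closed_eq.
by move=> x _; exact: is_norm_continuous.
Qed.

Lemma unit_sphere_neq0 x : unit_sphere N x -> x != 0.
Proof.
by apply: contraPneq => ->; rewrite /unit_sphere/= is_norm0 => /esym/eqP; rewrite oner_eq0.
Qed.

Lemma derive_grad (f : 'rV[R]_n -> R) x v : differentiable f x ->
  'D_v f x = dotp v (grad f x).
Proof.
move=> df; rewrite deriveE// {1}(row_sum_delta v) linear_sum /dotp.
by apply: eq_bigr => i _; rewrite linearZ /grad mxE deriveE.
Qed.

(** One-sided difference quotients suffice to bound a directional derivative from
below, since the two-sided limit exists. *)
Lemma derive_ge_right (f : 'rV[R]_n -> R) x v (a : R) : differentiable f x ->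
  (\forall h \near (0 : R)^'+, a <= h^-1 * (f (h *: v + x) - f x)) ->
  a <= dotp v (grad f x).
Proof.
move=> df; rewrite -derive_grad// => ah.
have /cvg_ex[l fl] := @diff_derivable _ _ _ f x v df.
have -> : 'D_v f x = l by exact: cvg_lim fl.
exact: cvgr_to_ge (cvg_dnbhs_at_right fl) ah.
Qed.

(** The gradient of a norm has dual norm at most 1. *)
Lemma dotp_grad_le x v : differentiable N x -> dotp v (grad N x) <= N v.
Proof.
move=> dN.
have : - N v <= dotp (- v) (grad N x); last first.
  by rewrite -(scaleN1r v) dotpZl mulN1r lerN2.
apply: derive_ge_right => //; near=> h.
have h0 : 0 < h by near: h; exact: nbhs_right_gt.
rewrite ler_pdivlMl// mulrN lerNl opprB.
apply: le_trans (is_norm_sub _ _) _.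
by rewrite scalerN opprD opprK addrCA subrr addr0 NZ gtr0_norm.
Unshelve. all: by end_near. Qed.

(** Euler's identity for the positively homogeneous function [N]. *)
Lemma dotp_grad_self x : differentiable N x -> dotp x (grad N x) = N x.
Proof.
move=> dN; apply/eqP; rewrite eq_le dotp_grad_le//=.
apply: derive_ge_right => //; near=> h.
have h0 : 0 < h by near: h; exact: nbhs_right_gt.
have -> : h *: x + x = (h + 1) *: x by rewrite scalerDl scale1r.
by rewrite ler_pdivlMl// NZ gtr0_norm ?addr_gt0// mulrDl mul1r addrK.
Unshelve. all: by end_near. Qed.

(** If the supporting hyperplane of the unit ball at [y] contains [x], it contains
the segment from [x] to [y], on which [N] is then at least 1; convexity gives
the other inequality and the segment lies on the sphere. *)
Lemma strict_norm_eq x y : contains_no_segment (unit_sphere N) ->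
  differentiable N y -> N x = 1 -> N y = 1 -> 1 <= dotp x (grad N y) -> x = y.
Proof.
move=> Nstrict dN Nx Ny xy; apply: contrapT => /eqP nxy.
apply: (Nstrict _ _ nxy) => z [t +] <- {z}; rewrite /= in_itv/= => /andP[t0 t1].
rewrite /unit_sphere/=; apply/eqP; rewrite eq_le; apply/andP; split.
  apply: le_trans (ND _ _) _.
  by rewrite !NZ Nx Ny !ger0_norm// ?subr_ge0// !mulr1 addrC subrK.
apply: le_trans (dotp_grad_le _ dN).
rewrite dotpDl !dotpZl dotp_grad_self// Ny mulr1.
by rewrite -[leLHS](subrK t) addrC lerD2r ler_peMr.
Qed.

End norm_facts.

(** * Hyperplane sections of a strictly convex sphere are null *)

Lemma affine_continuous {R : realType} {V : normedModType R} (a : R) (u v : V) :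
  continuous (fun y => a *: (y - u) + v).
Proof.
move=> x; apply: cvgD; last exact: cvg_cst.
by apply: cvgZr; apply: cvgB; [exact: cvg_id|exact: cvg_cst].
Qed.

Section hausdorff_null.
Context {R : realType} {n : nat}.
Variable d : nat.
Implicit Types A B U : set 'rV[R]_n.

Lemma enormZ (a : R) (x : 'rV[R]_n) : enorm (a *: x) = `|a| * enorm x.
Proof.
by rewrite /enorm dotpZl dotpZr mulrA -expr2 sqrtrM ?sqr_ge0// sqrtr_sqr.
Qed.

Lemma hausdorff_contraction (f : 'rV[R]_n -> 'rV[R]_n) A :
  (forall x y, enorm (f x - f y) <= enorm (x - y)) ->
  (hausdorff d (f @` A) <= hausdorff d A)%E.
Proof.
move=> f1; apply: ge_ereal_sup => _ [r r0 <-].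
apply: (@le_trans _ _ (hausdorff_pre d r A)); last first.
  by apply: ereal_sup_ubound; exists r.
apply: le_ereal_inf_tmp => _ [U [Ur AU] <-].
apply: (@le_trans _ _ (\sum_(k <oo) hausdorff_weight d (f @` U k))%E).
  apply: ereal_inf_lbound; exists (fun k => f @` U k) => //; split.
    by move=> k _ _ [x Ux <-] [y Uy <-]; exact: le_trans (f1 x y) (Ur k x y Ux Uy).
  by move=> _ [x Ax <-]; have [k _ Ux] := AU _ Ax; exists k => //; exists x.
apply: lee_nneseries => [k _ _|k _]; first exact: hausdorff_weight_ge0.
rewrite /hausdorff_weight; case: asboolP => [_|fU0].
  exact: (@hausdorff_weight_ge0 R n d (U k)).
rewrite asboolF; last by move=> U0; apply: fU0; rewrite U0 image_set0.
rewrite lee_fin ler_wpM2l ?unit_ball_volume_ge0//.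
rewrite lerXn2r ?nnegrE ?divr_ge0 ?ediam_ge0// ler_pM2r ?invr_gt0//.
apply: ediam_le; first exact: ediam_ge0.
move=> _ _ [x Ux <-] [y Uy <-]; apply: le_trans (f1 x y) _.
apply: ub_le_sup; last by exists (x, y).
by exists r => _ [[a b] [/= Ua Ub] <-]; exact: Ur Ua Ub.
Qed.

Lemma hausdorff_set1 (x : 'rV[R]_n) : (0 < d)%N -> hausdorff d [set x] = 0%E.
Proof.
move=> d0; apply/eqP; rewrite eq_le hausdorff_ge0 andbT.
have xx0 y z : [set x] y -> [set x] z -> enorm (y - z) <= 0.
  move=> -> ->; rewrite subrr (le_trans (enorm_le_norm _))//.
  by rewrite normr0 mulr0.
apply: ge_ereal_sup => _ [r /= r0 <-].
apply: (@le_trans _ _ (\sum_(i : unit) hausdorff_weight d [set x])%E).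
  apply: hausdorff_pre_finite_cover => [_ y z yx zx|y yx]; last by exists tt.
  exact: le_trans (xx0 y z yx zx) (ltW r0).
rewrite big_const card_unit /= adde0 /hausdorff_weight; case: ifP => // _.
have -> : ediam [set x] = 0.
  by apply/eqP; rewrite eq_le ediam_ge0 andbT; exact: ediam_le.
by rewrite mul0r expr0n eqn0Ngt d0 mulr0.
Qed.

End hausdorff_null.

(** If [q ord0 l != 0], the coordinates other than the [l]-th determine the points
of the hyperplane, in a Lipschitz way. *)
Lemma hyperplane_piece_lty (R : realType) (d : nat) (q : 'rV[R]_d.+1) (c K : R) :
  q != 0 -> (hausdorff d [set x : 'rV[R]_d.+1 | dotp x q = c /\ (`|x| <= K)%R] < +oo)%E.
Proof.
move=> q0.
have [l ql] : exists l, q ord0 l != 0.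
  apply: contrapT => nq; move/eqP: q0; apply; apply/rowP => l; rewrite mxE.
  by apply/eqP/negPn/negP => ql; apply: nq; exists l.
(* K' rescales coordinates in [- K, K] to [0, 1[ *)
pose K' : R := 2 * `|K| + 1.
have K'0 : 0 < K' by rewrite ltr_wpDl// mulr_ge0.
pose Q : R := \sum_(i | i != l) `|q ord0 i / q ord0 l|.
have Q0 : 0 <= Q by apply: sumr_ge0.
apply: (@hausdorff_coord_lty _ _ _ _ (fun x j => (x ord0 (lift l j) + `|K|) / K')
   (d.+1%:R * ((1 + Q) * K'))).
- by rewrite mulr_ge0// mulr_ge0 ?addr_ge0// ltW.
- move=> x j [_ xK].
  have := le_trans (coord_le_norm x (lift l j)) (le_trans xK (ler_norm K)).
  rewrite ler_norml => /andP[x1 x2].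
  apply/andP; split; first by apply: divr_ge0; [lra|exact: ltW].
  by rewrite ltr_pdivrMr// mul1r /K'; lra.
- move=> x y e [xc _] [yc _] e0 xye.
  have off i : i != l -> `|(x - y) ord0 i| <= e * K'.
    case: (unliftP l i) => [j ->|->]; last by rewrite eqxx.
    move=> _; rewrite -ler_pdivrMr// -[X in _ / X](gtr0_norm K'0) -normf_div.
    apply: le_trans (xye j); rewrite !mxE -mulrBl.
    by rewrite opprD addrACA subrr addr0.
  have atl : `|(x - y) ord0 l| <= Q * (e * K').
    have : dotp (x - y) q = 0 by rewrite dotpBl xc yc subrr.
    rewrite /dotp (bigD1 l)//= => /eqP; rewrite addr_eq0 => /eqP xyl.
    have -> : (x - y) ord0 l = - \sum_(i | i != l) (x - y) ord0 i * (q ord0 i / q ord0 l).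
      apply: (mulIf ql); rewrite xyl mulNr mulr_suml; congr (- _).
      by apply: eq_bigr => i _; rewrite -!mulrA mulVf// mulr1.
    rewrite normrN (le_trans (ler_norm_sum _ _ _))// mulr_suml.
    by apply: ler_sum => i il; rewrite normrM mulrC ler_wpM2l// off.
  apply: le_trans (enorm_le_norm _) _.
  rewrite -mulrA ler_wpM2l//.
  have eK0 : 0 <= e * K' by rewrite mulr_ge0// ltW.
  have -> : (1 + Q) * K' * e = e * K' + Q * (e * K') by ring.
  apply: norm_le_coord => [|i]; first by rewrite addr_ge0// mulr_ge0.
  have [->|il] := eqVneq i l; first by rewrite (le_trans atl)// lerDr.
  by rewrite (le_trans (off i il))// lerDl mulr_ge0.
Qed.

Section sphere_section.
Context {R : realType} {d : nat}.
Variable N : 'rV[R]_d.+1 -> R.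
Hypothesis normN : is_norm N.
Hypothesis d_gt0 : (0 < d)%N.
Hypothesis Nstrict : contains_no_segment (unit_sphere N).
Variables (q : 'rV[R]_d.+1) (c : R).
Hypothesis q_neq0 : q != 0.

Let ND : forall x y, N (x + y) <= N x + N y. Proof. by case: normN. Qed.
Let NZ : forall (a : R) x, N (a *: x) = `|a| * N x. Proof. by case: normN. Qed.

Let segmentN x y t : 0 <= t <= 1 ->
  N (t *: x + (1 - t) *: y) <= t * N x + (1 - t) * N y.
Proof.
move=> /andP[t0 t1]; apply: le_trans (ND _ _) _.
by rewrite !NZ !ger0_norm// subr_ge0.
Qed.

Let plane : set 'rV[R]_d.+1 := [set x | dotp x q = c].

Lemma plane_closed : closed plane.
Proof.
apply: (@closed_comp _ _ (fun x => dotp x q) [set c]); last exact: closed_eq.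
by move=> x _; exact: dotp_continuous.
Qed.

(** If the hyperplane does not enter the open unit ball, the section is convex, and
strict convexity reduces it to at most one point. *)
Lemma tangent_section_null :
  (forall z, plane z -> 1 <= N z) -> hausdorff d (unit_sphere N `&` plane) = 0%E.
Proof.
move=> N1.
have uniq x y : (unit_sphere N `&` plane) x -> (unit_sphere N `&` plane) y -> x = y.
  move=> [Nx xc] [Ny yc]; apply: contrapT => /eqP nxy.
  apply: (Nstrict nxy) => z [t +] <- {z}; rewrite /= in_itv/= => t01.
  apply/eqP; rewrite eq_le; apply/andP; split.
    by apply: le_trans (segmentN _ _ t01) _; rewrite Nx Ny; lra.
  by apply: N1; rewrite /plane/= dotpDl !dotpZl xc yc; ring.
have [[x Sx]|S0] := pselect (unit_sphere N `&` plane !=set0).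
  rewrite (_ : _ `&` _ = [set x]) ?hausdorff_set1//.
  by apply/seteqP; split => [y Sy|y ->//]; exact: uniq.
rewrite (_ : _ `&` _ = set0) ?hausdorff0//.
by apply/seteqP; split => // x Sx; apply: S0; exists x.
Qed.

Section dilations.
Variable z : 'rV[R]_d.+1.
Hypotheses (zc : plane z) (Nz : N z < 1).
Variable K : R.

Let S := unit_sphere N `&` plane `&` [set x | `|x| <= K].
Let contr (r : R) (y : 'rV[R]_d.+1) := r^-1 *: (y - z) + z.
Let dil (r : R) : set 'rV[R]_d.+1 := contr r @^-1` S.

Let S_closed : closed S.
Proof.
apply: closedI; first by apply: closedI; [exact: unit_sphere_closed|exact: plane_closed].
apply: (@closed_comp _ _ (fun x : 'rV[R]_d.+1 => `|x|) [set t | t <= K]);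
  last exact: closed_le.
by move=> x _; exact: norm_continuous.
Qed.

Let dil_closed r : closed (dil r).
Proof.
apply: closed_comp S_closed => x _.
exact: affine_continuous.
Qed.

Let le_dil r : 1 <= r -> (hausdorff d S <= hausdorff d (dil r))%E.
Proof.
move=> r1; have r0 : 0 < r by rewrite (lt_le_trans _ r1).
have -> : S = contr r @` dil r.
  apply/seteqP; split=> [x Sx|_ [y Sy <-]//].
  have xE : contr r (r *: (x - z) + z) = x.
    by rewrite /contr addrK scalerA mulVf ?gt_eqF// scale1r subrK.
  by exists (r *: (x - z) + z) => //; rewrite /dil/= xE.
apply: hausdorff_contraction => x y.
rewrite /contr opprD addrACA subrr addr0 -scalerBr enormZ.
rewrite (_ : x - z - (y - z) = x - y); last by rewrite opprD addrACA subrr addr0.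
rewrite ger0_norm ?invr_ge0 ?(ltW r0)// ler_piMl ?sqrtr_ge0//.
by rewrite invf_le1.
Qed.

Let dil_disjoint r s : 0 < r -> r < s -> dil r `&` dil s = set0.
Proof.
move=> r0 rs; have s0 := lt_trans r0 rs.
apply/seteqP; split => // y [[[Nr _] _] [[Ns _] _]].
have t01 : 0 <= r / s <= 1 by rewrite divr_ge0 ?(ltW r0) ?(ltW s0)//= ler_pdivrMr// mul1r ltW.
have := segmentN (contr r y) z t01.
have -> : r / s *: contr r y + (1 - r / s) *: z = contr s y.
  rewrite /contr scalerDr scalerA mulrAC mulfV ?gt_eqF// mul1r -addrA -scalerDl.
  by rewrite [r / s + _]addrC subrK scale1r.
rewrite Nr Ns; apply/negP; rewrite -ltNge mulr1 -ltrBrDl gtr_pMr//.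
by rewrite subr_gt0 ltr_pdivrMr// mul1r.
Qed.

Let dil_bounded r : 1 <= r <= 2 ->
  dil r `<=` [set x | dotp x q = c /\ `|x| <= 2 * (K + `|z|) + `|z|].
Proof.
move=> /andP[r1 r2] y [[_ yc] yK].
have r0 : 0 < r by rewrite (lt_le_trans _ r1).
have yE : y = r *: (contr r y - z) + z.
  by rewrite /contr addrK scalerA mulfV ?gt_eqF// scale1r subrK.
rewrite yE; split.
  by rewrite dotpDl dotpZl dotpBl yc zc subrr mulr0 add0r.
rewrite (le_trans (ler_normD _ _))// lerD2r normrZ gtr0_norm//.
rewrite ler_pM ?(ltW r0)// (le_trans (ler_normB _ _))// lerD2r.
exact: yK.
Qed.

(** The dilations of [S] of centre [z] and ratios [1 + 1/(i+1)] are disjoint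
because [N z < 1], their measures are at least that of [S], and they all lie in
a bounded piece of the hyperplane, of finite measure. *)
Lemma bounded_section_null : hausdorff d S = 0%E.
Proof.
apply/eqP; rewrite eq_le hausdorff_ge0 andbT leNgt; apply/negP => S0.
pose r (i : nat) : R := 1 + i.+1%:R^-1.
have r12 i : 1 <= r i <= 2.
  by rewrite /r lerDl invr_ge0 ler0n/= lerD2l invf_le1 ?ler1n// ltr0n.
pose mu : {measure set (surfaceType R d.+1) -> \bar R} := surface_measure R d.+1.
pose B : set 'rV[R]_d.+1 := [set x | dotp x q = c /\ `|x| <= 2 * (K + `|z|) + `|z|].
have Boo : (hausdorff d B < +oo)%E by exact: hyperplane_piece_lty.
have mdil i : measurable (dil (r i) : set (surfaceType R d.+1)).
  exact: closed_surface_measurable.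
have sumE : mu (\bigcup_i dil (r i)) = (\sum_(i <oo) mu (dil (r i)))%E.
  apply: (@measure_semi_bigcup _ _ _ mu) => //; last exact: bigcupT_measurable.
  apply: ltn_trivIset => j i ij.
  rewrite setIC; apply: dil_disjoint => //.
    by rewrite (lt_le_trans (@ltr01 R))//; have /andP[] := r12 j.
  by rewrite /r ltrD2l ltf_pV2 ?posrE ?ltr0n// ltr_nat.
have sumB : (\sum_(i <oo) mu (dil (r i)) <= hausdorff d B)%E.
  rewrite -sumE; apply: le_hausdorff => x [i _]; exact: dil_bounded.
have Sfin : hausdorff d S \is a fin_num.
  rewrite ge0_fin_numE ?hausdorff_ge0//.
  have /andP[r1 _] := r12 0%N; apply: le_lt_trans (le_dil r1) _.
  apply: le_lt_trans Boo; apply: le_hausdorff; exact: dil_bounded.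
have Bfin : hausdorff d B \is a fin_num by rewrite ge0_fin_numE ?hausdorff_ge0.
move: S0; rewrite -(fineK Sfin) lte_fin => S0.
pose J := (Num.truncn (fine (hausdorff d B) / fine (hausdorff d S))).+1.
have : (\sum_(0 <= i < J) (fine (hausdorff d S))%:E <= hausdorff d B)%E.
  apply: le_trans sumB.
  apply: le_trans; last first.
    by apply: (@nneseries_lim_ge _ _ xpredT 0 J) => i _ _; exact: measure_ge0.
  apply: lee_sum => i _; rewrite fineK//; apply: le_dil.
  by have /andP[] := r12 i.
rewrite sumEFin -(fineK Bfin) lee_fin sumr_const_nat subn0 leNgt -mulr_natl => /negP; apply.
by rewrite -ltr_pdivrMr// truncnS_gt.
Qed.

End dilations.

Lemma sphere_section_null : hausdorff d (unit_sphere N `&` plane) = 0%E.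
Proof.
have [[z [zc Nz]]|tangent] := pselect (exists z, plane z /\ N z < 1); last first.
  apply: tangent_section_null => z zc; rewrite leNgt; apply/negP => Nz.
  by apply: tangent; exists z.
apply/eqP; rewrite eq_le hausdorff_ge0 andbT.
pose S k := unit_sphere N `&` plane `&` [set x | `|x| <= k%:R].
apply: (@le_trans _ _ (hausdorff d (\bigcup_k S k))).
  apply: le_hausdorff => x Sx; exists (Num.truncn `|x|).+1 => //; split => //.
  by apply/ltW/truncnS_gt.
apply: le_trans (hausdorff_sigma_subadditive d S) _.
by rewrite eseries0// => k _ _; exact: bounded_section_null zc Nz _.
Qed.

End sphere_section.

(** * Open pieces of a sphere have positive measure *)

Lemma dist_continuous {R : realType} {V : normedModType R} (u : V) :
  continuous (fun x => `|u - x|).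
Proof. by move=> x; apply: cvg_norm; apply: cvgB; [exact: cvg_cst|exact: cvg_id]. Qed.

Lemma normalize_continuous {R : realType} {V : normedModType R} (f : V -> R) (x : V) :
  {for x, continuous f} -> f x != 0 -> {for x, continuous (fun y => (f y)^-1 *: y)}.
Proof. by move=> cf fx; apply: cvgZ; [exact: cvgV|exact: cvg_id]. Qed.

(** Central projection to the sphere of a small cube of the hyperplane
[x ord0 l = x0 ord0 l] has a Lipschitz inverse. *)
Lemma sphere_open_gt0 (R : realType) (d : nat) (N : 'rV[R]_d.+1 -> R)
    (V : set 'rV[R]_d.+1) (x0 : 'rV[R]_d.+1) :
  is_norm N -> open V -> V x0 -> unit_sphere N x0 ->
  (0 < hausdorff d (V `&` unit_sphere N))%E.
Proof.
move=> normN oV Vx0 Nx0.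
have [l al] : exists l, x0 ord0 l != 0.
  apply: contrapT => nx; move/eqP: (unit_sphere_neq0 normN Nx0); apply.
  apply/rowP => l; rewrite mxE.
  by apply/eqP/negPn/negP => xl; apply: nx; exists l.
have a0 : 0 < `|x0 ord0 l| by rewrite normr_gt0.
have : nbhs x0 V by exact: open_nbhs_nbhs.
move=> /nbhs_normP[r /= r0 rV].
pose G (y : 'rV[R]_d.+1) := (N y)^-1 *: y.
have Gx0 : G x0 = x0 by rewrite /G Nx0 invr1 scale1r.
have Gc : {for x0, continuous G}.
  apply: normalize_continuous; first exact: is_norm_continuous.
  by rewrite Nx0 oner_neq0.
have : nbhs x0 (fun y => `|G x0 - G y| < r / 2).
  by have /cvgr_dist_lt := Gc; apply; rewrite divr_gt0.
move=> /nbhs_normP[s' /= s'0 s'G].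
have : nbhs x0 (fun y => 0 < N y).
  have /cvgr_gt := is_norm_continuous normN (x := x0).
  by apply; rewrite Nx0.
move=> /nbhs_normP[s'' /= s''0 s''N].
pose s := Num.min s' s'' / 2.
have s0 : 0 < s by rewrite divr_gt0// lt_min s'0.
have [ss' ss''] : s < s' /\ s < s''.
  have : s < Num.min s' s'' by rewrite ltr_pdivrMr// ltr_pMr ?ltr1n// lt_min s'0.
  by rewrite lt_min => /andP[].
pose y (t : 'I_d -> R) : 'rV[R]_d.+1 :=
  \row_i (x0 ord0 i + s * (if unlift l i is Some j then t j else 0)).
have yl t : y t ord0 l = x0 ord0 l by rewrite mxE unlift_none mulr0 addr0.
have yj t j : y t ord0 (lift l j) = x0 ord0 (lift l j) + s * t j.
  by rewrite mxE liftK.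
have yx0 t : (forall j, 0 <= t j <= 1) -> `|x0 - y t| <= s.
  move=> t01; apply: norm_le_coord => [|i]; first exact: ltW.
  rewrite !mxE opprD addrA subrr add0r normrN normrM gtr0_norm// ler_piMr ?(ltW s0)//.
  case: unliftP => [j _|_]; last by rewrite normr0.
  by have /andP[? ?] := t01 j; rewrite ger0_norm.
pose phi t := G (y t).
pose C := unit_sphere N `&` [set x | `|x0 - x| <= r / 2].
have cC : compact C.
  apply: bounded_closed_compact.
    exists (`|x0| + r / 2); split; first exact: num_real.
    move=> M xM x [_ /= xr]; rewrite ltW// (le_lt_trans _ xM)//.
    by rewrite -lerBlDl (le_trans _ xr)// distrC lerB_dist.
  apply: closedI; first exact: unit_sphere_closed.
  apply: (@closed_comp _ _ (fun x : 'rV[R]_d.+1 => `|x0 - x|) [set t | t <= r / 2]);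
    last exact: closed_le.
  by move=> x _; exact: dist_continuous.
apply: (@lt_le_trans _ _ (hausdorff d C)); last first.
  apply: le_hausdorff => x [Nx /= xr]; split => //; apply: rV => /=.
  by rewrite (le_lt_trans xr)// ltr_pdivrMr// ltr_pMr// ltr1n.
have [K K0 NK] : exists2 K, 0 <= K & forall x, N x <= K * `|x|.
  exists (\sum_(i < d.+1) N (delta_mx ord0 i)); last exact: is_norm_le.
  by apply: sumr_ge0 => i _; exact: is_norm_ge0.
pose Y := `|x0| + s.
have Y0 : 0 <= Y by rewrite addr_ge0// ltW.
have yY t : (forall j, 0 <= t j <= 1) -> `|y t| <= Y.
  move=> t01; rewrite -lerBlDl (le_trans _ (yx0 t t01))//.
  by rewrite distrC lerB_dist.
have Ny0 t : (forall j, 0 <= t j <= 1) -> 0 < N (y t).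
  by move=> t01; apply: s''N => /=; rewrite (le_lt_trans (yx0 t t01)).
apply: (@hausdorff_grid_gt0 R _ d C phi (K * Y * (1 + Y / `|x0 ord0 l|) / s)) => //.
- by rewrite divr_ge0 ?(ltW s0)// mulr_ge0// ?mulr_ge0// addr_ge0// divr_ge0// ltW.
- move=> t t01; split.
    have [_ NZ _] := normN.
    rewrite /unit_sphere/= /phi /G NZ normfV gtr0_norm ?Ny0//.
    by rewrite mulVf// gt_eqF// Ny0.
  rewrite /= -[X in `|X - _|]Gx0 ltW//; apply: s'G => /=.
  by rewrite (le_lt_trans (yx0 t t01)).
- move=> t t' t01 t'01 j.
  set D := `|phi t - phi t'|.
  have Dc i : `|phi t ord0 i - phi t' ord0 i| <= D.
    by apply: le_trans (coord_le_norm (phi t - phi t') i); rewrite !mxE.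
  have u0 := Ny0 t t01; have u'0 := Ny0 t' t'01.
  set u := N (y t) in u0; set u' := N (y t') in u'0.
  have phiE i : phi t ord0 i = y t ord0 i / u by rewrite mxE mulrC.
  have phi'E i : phi t' ord0 i = y t' ord0 i / u' by rewrite mxE mulrC.
  have uK : u <= K * Y.
    by rewrite (le_trans (NK _))// ler_wpM2l// yY.
  (* the l-th coordinates of y t and y t' coincide, which recovers u and u' from phi *)
  have key : s * (t j - t' j) = u * (phi t ord0 (lift l j) - phi t' ord0 (lift l j))
     + u * (phi t' ord0 l - phi t ord0 l) * (y t' ord0 (lift l j) / x0 ord0 l).
    rewrite !phiE !phi'E !yl.
    have -> : s * (t j - t' j) = y t ord0 (lift l j) - y t' ord0 (lift l j).
      by rewrite !yj; ring.
    by field; rewrite al !gt_eqF.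
  rewrite mulrAC ler_pdivlMr//.
  rewrite -[X in _ * X]gtr0_norm// -normrM mulrC key.
  apply: le_trans (ler_normD _ _) _.
  rewrite !normrM normfV (gtr0_norm u0) -[u * _ * _]mulrA.
  have yjY : `|y t' ord0 (lift l j)| <= Y.
    by apply: le_trans (coord_le_norm _ _) (yY t' t'01).
  have D0 : 0 <= D by rewrite /D.
  have -> : K * Y * (1 + Y / `|x0 ord0 l|) * D
          = K * Y * D + K * Y * (D * (Y / `|x0 ord0 l|)) by ring.
  have a'0 : 0 <= `|x0 ord0 l|^-1 by rewrite invr_ge0.
  have yjY' : `|y t' ord0 (lift l j)| / `|x0 ord0 l| <= Y / `|x0 ord0 l|.
    exact: ler_wpM2r.
  apply: lerD; first exact: ler_pM (ltW u0) (normr_ge0 _) uK (Dc _).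
  apply: ler_pM (ltW u0) _ uK _; first by rewrite mulr_ge0// mulr_ge0.
  apply: ler_pM => //.
  by rewrite distrC.
Qed.

(** * Where two refracting surfaces touch *)

Lemma line_cvg {R : realType} {V : normedModType R} (v x : V) :
  (fun h : R => h *: v + x) @ (0 : R)^'+ --> x.
Proof.
rewrite -[X in _ --> X]add0r -(scale0r v).
apply: cvgD; last exact: cvg_cst.
by apply: cvgZr_tmp; apply: cvg_at_right_filter; exact: cvg_id.
Qed.

Lemma gradZ {R : realType} {n : nat} (f : 'rV[R]_n -> R) (a : R) x :
  differentiable f x -> grad (a \*: f) x = a *: grad f x.
Proof.
move=> df; apply/rowP => i; rewrite !mxE deriveZ//.
exact: diff_derivable.
Qed.

(** Lagrange multipliers on the unit sphere: by homogeneity the constraint turns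
into the inequality [dotp y q <= lambda * N y] for all [y] near [x0], with
equality at [x0], and both sides are differentiated there. *)
Lemma sphere_contact_gradient {R : realType} {n : nat} (N : 'rV[R]_n -> R)
    (x0 q : 'rV[R]_n) (lambda : R) :
  is_norm N -> differentiable N x0 -> N x0 = 1 -> dotp x0 q = lambda ->
  (\forall x \near x0, N x = 1 -> dotp x q <= lambda) ->
  forall v, dotp v q <= lambda * dotp v (grad N x0).
Proof.
move=> normN dN Nx0 x0q xq v.
rewrite -dotpZr -gradZ//.
apply: derive_ge_right; first exact: differentiableZ.
have [_ NZ _] := normN.
pose G (y : 'rV[R]_n) := (N y)^-1 *: y.
have Gc : {for x0, continuous G}.
  apply: normalize_continuous; first exact: is_norm_continuous.
  by rewrite Nx0 oner_neq0.
have Gx0 : G x0 = x0 by rewrite /G Nx0 invr1 scale1r.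
have Pq : \forall y \near x0, 0 < N y -> dotp y q <= lambda * N y.
  have : \forall y \near x0, N (G y) = 1 -> dotp (G y) q <= lambda.
    by apply: (Gc [set z | N z = 1 -> dotp z q <= lambda]); rewrite Gx0.
  apply: filterS => y + Ny.
  rewrite /G NZ normfV gtr0_norm// mulVf ?gt_eqF// => /(_ erefl).
  by rewrite dotpZl mulrC ler_pdivrMr.
have N0 : \forall y \near x0, 0 < N y.
  have /cvgr_gt := is_norm_continuous normN (x := x0).
  by apply; rewrite Nx0.
have line := @line_cvg R _ v x0.
near=> h.
have h0 : 0 < h by near: h; exact: nbhs_right_gt.
have lE (u : R) : lambda *: u = lambda * u by [].
rewrite ler_pdivlMl//= !lE Nx0 mulr1.
have : dotp (h *: v + x0) q <= lambda * N (h *: v + x0).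
  have : 0 < N (h *: v + x0) by near: h; exact: line N0.
  by near: h; exact: line Pq.
by rewrite dotpDl dotpZl x0q lerBrDr.
Unshelve. all: by end_near. Qed.

(** The hypothesis says that the surface of parameters [b'], [m'] is below that of
parameters [b], [m] near [x0] and touches it at [x0], written without
denominators.  By the Lagrange condition
[b *: grad N2 m' - b' *: grad N2 m = (b - b') *: grad N1 x0]; it is paired with
[m] if [b' <= b], and with [m'] otherwise. *)
Lemma contact_unique {R : realType} {n : nat} (N1 N2 : 'rV[R]_n -> R)
    (x0 m m' : 'rV[R]_n) (b b' : R) :
  is_norm N1 -> is_norm N2 -> contains_no_segment (unit_sphere N2) ->
  differentiable N1 x0 -> differentiable N2 m -> differentiable N2 m' ->
  N1 x0 = 1 -> N2 m = 1 -> N2 m' = 1 -> 0 < b -> 0 < b' ->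
  1 <= dotp m (grad N1 x0) -> 1 <= dotp m' (grad N1 x0) ->
  b' * (1 - dotp x0 (grad N2 m)) = b * (1 - dotp x0 (grad N2 m')) ->
  (\forall x \near x0, N1 x = 1 ->
     b' * (1 - dotp x (grad N2 m)) <= b * (1 - dotp x (grad N2 m'))) ->
  m = m'.
Proof.
move=> normN1 normN2 strict d1 d2 d2' Nx0 Nm Nm' b0 b'0 mx0 m'x0 touch above.
pose q := b *: grad N2 m' - b' *: grad N2 m.
have qE x : dotp x q = b * dotp x (grad N2 m') - b' * dotp x (grad N2 m).
  by rewrite dotpBr !dotpZr.
have x0q : dotp x0 q = b - b' by rewrite qE; lra.
have Dq : forall v, dotp v q <= (b - b') * dotp v (grad N1 x0).
  apply: sphere_contact_gradient => //.
  by apply: filterS above => x + Nx => /(_ Nx); rewrite qE; lra.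
have Dq' v : dotp v q = (b - b') * dotp v (grad N1 x0).
  apply/eqP; rewrite eq_le Dq/=.
  by have := Dq (- v); rewrite -scaleN1r !dotpZl; lra.
have [bb'|bb'] := leP b' b.
  apply: (strict_norm_eq normN2) => //.
  have := Dq' m; rewrite qE dotp_grad_self// Nm mulr1 => mq.
  have : (b - b') * 1 <= (b - b') * dotp m (grad N1 x0).
    by rewrite ler_wpM2l// subr_ge0.
  rewrite -mq -(ler_pM2l b0); lra.
apply/esym; apply: (strict_norm_eq normN2) => //.
have := Dq' m'; rewrite qE dotp_grad_self// Nm' mulr1 => mq.
have : (b - b') * dotp m' (grad N1 x0) <= (b - b') * 1.
  by rewrite ler_wnM2l// subr_le0 ltW.
rewrite -mq -(ler_pM2l b'0); lra.
Qed.

(** * Cells of a minimum of finitely many functions *)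

Section cells.
Context {R : realType} {T : Type} {k : nat}.
Variables (Omega : set T) (w : 'I_k.+1 -> T -> R).
Implicit Types (b c : 'I_k.+1 -> R) (i j : 'I_k.+1).

(** The points where [b i / w i] is the least of the [b j / w j], without
denominators. *)
Definition cell b i : set T :=
  [set x | Omega x /\ forall j, b i * w j x <= b j * w i x].

Definition interface b i j : set T :=
  [set x | Omega x /\ b i * w j x = b j * w i x].

Definition update b i (t : R) : 'I_k.+1 -> R := fun j => if j == i then t else b j.

Definition overlap b : set T :=
  \bigcup_(p in [set p : 'I_k.+1 * 'I_k.+1 | p.1 != p.2])
    interface b p.1 p.2.

Lemma cell_overlap b i j x : i != j -> cell b i x -> cell b j x ->
  overlap b x.
Proof.
move=> ij [Ox xi] [_ xj]; exists (i, j) => //=; split => //.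
by apply/eqP; rewrite eq_le xi xj.
Qed.

Hypothesis w_gt0 : forall i x, Omega x -> 0 < w i x.

Lemma update_eq b i t : update b i t i = t.
Proof. by rewrite /update eqxx. Qed.

Lemma update_neq b i t j : j != i -> update b i t j = b j.
Proof. by rewrite /update => /negbTE ->. Qed.

Lemma sub_cell b c i : b i <= c i -> (forall j, j != i -> c j <= b j) ->
  cell c i `<=` cell b i.
Proof.
move=> bci cb x [Ox cx]; split => // j.
have [->//|ji] := eqVneq j i.
apply: (@le_trans _ _ (c i * w j x)).
  by rewrite ler_wpM2r// ltW// w_gt0.
by rewrite (le_trans (cx j))// ler_wpM2r ?cb// ltW// w_gt0.
Qed.

Lemma cells_cover b x : Omega x -> exists i, cell b i x.
Proof.
move=> Ox.
have [i _ imin] := arg_minP (fun i => b i / w i x) (isT : xpredT ord0).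
exists i; split => // j.
have := imin j isT.
by rewrite ler_pdivrMr ?w_gt0// mulrAC ler_pdivlMr ?w_gt0.
Qed.

End cells.

Section cell_measure.
Context d {T : measurableType d} {R : realType} {k : nat}.
Variables (nu : {measure set T -> \bar R}) (Omega : set T) (w : 'I_k.+1 -> T -> R).
Implicit Types (b c : 'I_k.+1 -> R) (i j : 'I_k.+1).

Hypothesis minterface : forall b i j, measurable (interface Omega w b i j).
Hypothesis interface_null : forall b i j, (forall l, 0 < b l) -> i != j ->
  nu (interface Omega w b i j) = 0%E.

Lemma overlap_measurable b : measurable (overlap Omega w b).
Proof.
apply: fin_bigcup_measurable => [|p _]; last exact: minterface.
exact: finite_finset.
Qed.

Lemma overlap_null b : (forall l, 0 < b l) -> nu (overlap Omega w b) = 0%E.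
Proof.
move=> b0; apply/eqP; rewrite eq_le measure_ge0 andbT.
pose F (n : nat) : set T :=
  if (choice.unpickle n : option ('I_k.+1 * 'I_k.+1)) is Some p then
    (if p.1 != p.2 then interface Omega w b p.1 p.2 else set0) else set0.
have mF n : measurable (F n).
  by rewrite /F; case: choice.unpickle => // p; case: ifP => // _; exact: minterface.
apply: le_trans; first apply: (measure_sigma_subadditive nu mF).
- exact: overlap_measurable.
- move=> x [p /= pneq px]; exists (choice.pickle p) => //.
  by rewrite /F choice.pickleK pneq.
rewrite eseries0// => n _ _; rewrite /F; case: choice.unpickle => [p|]; last exact: measure0.
by case: ifP => [pneq|_]; [exact: interface_null|exact: measure0].
Qed.

End cell_measure.

Lemma measure_eq_off_null {d} {T : measurableType d} {R : realType}
    (nu : {measure set T -> \bar R}) (A B Z : set T) :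
  measurable A -> measurable B -> measurable Z -> nu Z = 0%E ->
  A `\` Z = B `\` Z -> nu A = nu B.
Proof.
move=> mA mB mZ Z0 AB.
have off C : measurable C -> nu C = nu (C `\` Z).
  move=> mC; rewrite (measureDI nu mC mZ).
  rewrite [X in (_ + X)%E](_ : _ = 0%E) ?adde0//.
  apply/eqP; rewrite eq_le measure_ge0 andbT -Z0.
  apply: le_measure => //; apply/mem_set => //; exact: measurableI.
by rewrite off// AB -off.
Qed.

Section cell_measure_sum.
Context d {T : measurableType d} {R : realType} {k : nat}.
Variables (nu : {measure set T -> \bar R}) (Omega : set T) (w : 'I_k.+1 -> T -> R).
Implicit Types (b c : 'I_k.+1 -> R) (i j : 'I_k.+1).

Hypothesis w_gt0 : forall i x, Omega x -> 0 < w i x.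
Hypothesis mcell : forall b i, measurable (cell Omega w b i).
Hypothesis minterface : forall b i j, measurable (interface Omega w b i j).
Hypothesis interface_null : forall b i j, (forall l, 0 < b l) -> i != j ->
  nu (interface Omega w b i j) = 0%E.

Lemma bigcup_cell_measurable b (P : pred 'I_k.+1) :
  measurable (\bigcup_(i in [set i | P i]) cell Omega w b i).
Proof. by apply: fin_bigcup_measurable => [|i _]; [exact: finite_finset|]. Qed.

(** Cells overlap only along interfaces, which are null. *)
Lemma measure_cells b (P : pred 'I_k.+1) : (forall l, 0 < b l) ->
  nu (\bigcup_(i in [set i | P i]) cell Omega w b i)
  = (\sum_(i | P i) nu (cell Omega w b i))%E.
Proof.
move=> b0; pose Z := overlap Omega w b.
have mZ : measurable Z by exact: overlap_measurable.
have Z0 : nu Z = 0%E by exact: overlap_null.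
pose C i := cell Omega w b i `\` Z.
have mC i : measurable (C i) by exact: measurableD.
rewrite (@measure_eq_off_null _ _ _ _ _ (\big[setU/set0]_(i < k.+1 | P i) C i) Z)//.
- rewrite measure_bigsetU_ord//; last first.
    apply/trivIsetP => i j _ _ ij; apply/seteqP; split => // x [[xi nZ] [xj _]].
    by apply: nZ; exact: cell_overlap ij xi xj.
  apply: eq_bigr => i _; apply: measure_eq_off_null mZ Z0 _ => //.
  by rewrite /C setDDl setUid.
- exact: bigcup_cell_measurable.
- exact: bigsetU_measurable.
- rewrite -[X in _ = X `\` _](bigcup_pred (fun i => P i)).
  apply/seteqP; split => x [[i Pi xi] nZ]; split => //; exists i => //.
  by case: xi.
Qed.

Lemma sum_cells b : (forall l, 0 < b l) -> measurable Omega ->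
  (\sum_i nu (cell Omega w b i))%E = nu Omega.
Proof.
move=> b0 mO; rewrite -measure_cells//; congr (nu _).
apply/seteqP; split => [x [i _ []]//|x Ox].
by have [i xi] := cells_cover w_gt0 b Ox; exists i.
Qed.

End cell_measure_sum.

(** * Existence of parameters with prescribed cell measures *)

Section cell_existence.
Context d {T : measurableType d} {R : realType} {k : nat}.
Variables (nu : {measure set T -> \bar R}) (Omega : set T) (w : 'I_k.+1 -> T -> R).
Implicit Types (b c : 'I_k.+1 -> R) (i j : 'I_k.+1).

Hypothesis w_gt0 : forall i x, Omega x -> 0 < w i x.
Hypothesis mcell : forall b i, measurable (cell Omega w b i).
Hypothesis minterface : forall b i j, measurable (interface Omega w b i j).
Hypothesis interface_null : forall b i j, (forall l, 0 < b l) -> i != j ->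
  nu (interface Omega w b i j) = 0%E.
Hypothesis mOmega : measurable Omega.
Variables (lo hi : R).
Hypothesis lo_gt0 : 0 < lo.
Hypothesis w_bounded : forall i x, Omega x -> lo <= w i x <= hi.
Variables (g : 'I_k.+1 -> R) (b1 : R).
Hypothesis g_gt0 : forall i, 0 < g i.
Hypothesis b1_gt0 : 0 < b1.
Hypothesis nu_Omega : nu Omega = (\sum_i g i)%:E.

Local Notation cell := (cell Omega w).

(** The inequality is not imposed on the cell of index 0, which absorbs what the
other cells leave. *)
Definition admissible : set ('I_k.+1 -> R) :=
  [set b | [/\ b ord0 = b1, forall i, 0 < b i &
               forall i, i != ord0 -> (nu (cell b i) <= (g i)%:E)%E]].

Let le_cell b c i j : cell b i `<=` cell c j -> (nu (cell b i) <= nu (cell c j))%E.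
Proof. by move=> bc; apply: le_measure => //; apply/mem_set; exact: mcell. Qed.

Let Omega_neq0 : exists x, Omega x.
Proof.
apply: contrapT => O0; have : nu Omega = 0%E.
  rewrite (_ : Omega = set0) ?measure0//.
  by apply/seteqP; split => // x Ox; apply: O0; exists x.
rewrite nu_Omega => /eqP; rewrite eqe => /eqP.
apply/eqP; rewrite gt_eqF// big_ord_recl ltr_wpDr//.
by apply: sumr_ge0 => i _; exact/ltW.
Qed.

Let hi_gt0 : 0 < hi.
Proof.
have [x Ox] := Omega_neq0.
by have /andP[lw wh] := w_bounded ord0 Ox; rewrite (lt_le_trans lo_gt0)// (le_trans lw).
Qed.

Lemma admissible_nonempty : admissible !=set0.
Proof.
(* with such large values the cells of nonzero index are empty *)
pose B := b1 * hi / lo + 1.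
have B0 : 0 < B by rewrite addr_gt0// divr_gt0// mulr_gt0.
exists (fun i => if i == ord0 then b1 else B); split => [|i|i i0].
- by rewrite eqxx.
- by case: ifP.
rewrite (_ : cell _ _ = set0) ?measure0 ?lee_fin; first exact/ltW.
apply/seteqP; split => // x [Ox /(_ ord0)].
rewrite (negbTE i0) eqxx; apply/negP; rewrite -ltNge.
have /andP[_ wi] := w_bounded i Ox; have /andP[w0 _] := w_bounded ord0 Ox.
apply: (@le_lt_trans _ _ (b1 * hi)); first by rewrite ler_pM2l.
apply: (@lt_le_trans _ _ (B * lo)); last by rewrite ler_pM2l.
by rewrite -ltr_pdivrMr// ltrDl.
Qed.

(** If the cell of index 0 were empty, the other cells would carry the whole mass,
which exceeds the sum of the [g i] over [i != ord0].  So it contains a point,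
where [b ord0 / w ord0 <= b i / w i]. *)
Lemma admissible_ge b i : admissible b -> b1 * lo / hi <= b i.
Proof.
move=> [b0 bpos bg].
have [x [Ox x0]] : exists x, cell b ord0 x.
  apply: contrapT => c0.
  have := sum_cells w_gt0 mcell minterface interface_null bpos mOmega.
  rewrite nu_Omega !big_ord_recl (_ : cell b ord0 = set0) ?measure0 ?add0e; last first.
    by apply/seteqP; split => // x cx; apply: c0; exists x.
  move=> gE.
  have : (\sum_(i < k) (g (lift ord0 i))%:E >= (g ord0 + \sum_(i < k) g (lift ord0 i))%:E)%E.
    by rewrite -gE; apply: lee_sum => j _; exact: bg.
  by rewrite sumEFin lee_fin leNgt ltrDr g_gt0.
have /andP[lwi _] := w_bounded i Ox; have /andP[_ hw0] := w_bounded ord0 Ox.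
rewrite ler_pdivrMr//.
apply: (@le_trans _ _ (b ord0 * w i x)); first by rewrite b0 ler_pM2l.
by apply: le_trans (x0 i) _; rewrite ler_pM2l.
Qed.

Definition least i : R := inf [set b i | b in admissible].

Let values_inf i : has_inf [set b i | b in admissible].
Proof.
split; first by have [b bW] := admissible_nonempty; exists (b i), b.
by exists (b1 * lo / hi) => _ [b bW <-]; exact: admissible_ge.
Qed.

Lemma least_le b i : admissible b -> least i <= b i.
Proof. by move=> bW; apply: inf_lbound; [exact: (values_inf i).2|exists b]. Qed.

Lemma least_gt0 i : 0 < least i.
Proof.
apply: (@lt_le_trans _ _ (b1 * lo / hi)); first by rewrite divr_gt0// mulr_gt0.
apply: lb_le_inf; first exact: (values_inf i).1.
by move=> _ [b bW <-]; exact: admissible_ge.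
Qed.

Lemma least0 : least ord0 = b1.
Proof.
rewrite /least (_ : [set _ | _ in _] = [set b1]) ?inf1//.
apply/seteqP; split => [_ [b [b0 _ _] <-]//|_ ->].
by have [b bW] := admissible_nonempty; exists b => //; case: bW.
Qed.

(** The coordinatewise minimum [b] agrees with some [c i] at the index [l], and
[b <= c i] elsewhere, hence its cell of index [l] is contained in that of [c i]. *)
Lemma admissible_min (c : 'I_k.+1 -> 'I_k.+1 -> R) : (forall i, admissible (c i)) ->
  admissible (fun l => \big[Num.min/c ord0 l]_i c i l).
Proof.
move=> cW.
have attained l : exists i, \big[Num.min/c ord0 l]_i c i l = c i l.
  elim/big_ind: _ => [|x y [i ->] [j ->]|i _]; [by exists ord0| |by exists i].
  by rewrite minEle; case: ifP => _; [exists i|exists j].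
have le_c i l : \big[Num.min/c ord0 l]_i c i l <= c i l.
  by exact: bigmin_le_cond.
split => [|l|l l0].
- by have [i ->] := attained ord0; case: (cW i).
- by have [i ->] := attained l; case: (cW i).
have [i iE] := attained l; have [_ _ /(_ l l0)] := cW i.
apply: le_trans; apply: le_cell.
apply: (sub_cell w_gt0) => //; first by rewrite iE.
Qed.

(** Stability under minimum makes the infimum approachable simultaneously in all
coordinates, by a single admissible family. *)
Lemma admissible_near_least (delta : R) : 0 < delta ->
  exists2 c, admissible c & forall i, c i <= (1 + delta) * least i.
Proof.
move=> delta0.
have cE i : exists2 c, admissible c & c i <= (1 + delta) * least i.
  have e0 : 0 < delta * least i by rewrite mulr_gt0// least_gt0.
  have [_ [c cW <-] ci] := inf_adherent e0 (values_inf i).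
  by exists c => //; rewrite ltW// mulrDl mul1r.
have [c cP] := choice (fun i => let: ex_intro2 c cW ci := cE i in ex_intro _ c (conj cW ci)).
exists (fun l => \big[Num.min/c ord0 l]_i c i l).
  by apply: admissible_min => i; case: (cP i).
move=> l; apply: le_trans (cP l).2; exact: bigmin_le_cond.
Qed.

(** Multiplying the [i]-th coordinate of [least] by a factor slightly larger than 1
gives a cell contained in the cell of an admissible family close to [least]; as
the factor tends to 1 these cells exhaust the cell of [least], up to interfaces. *)
Lemma least_admissible : admissible least.
Proof.
split => [|i|i i0]; [exact: least0|exact: least_gt0|].
pose D n : 'I_k.+1 -> R := update least i ((1 + n.+1%:R^-1) * least i).
pose B n := cell (D n) i.
have Bg n : (nu (B n) <= (g i)%:E)%E.
  have n0 : 0 < (n.+1%:R : R)^-1 by rewrite invr_gt0 ltr0n.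
  have [c cW cle] := admissible_near_least n0.
  have [_ _ /(_ i i0)] := cW; apply: le_trans.
  apply: le_cell; apply: (sub_cell w_gt0) => // [|j ji]; first by rewrite /D update_eq.
  by rewrite /D update_neq// least_le.
have ndB : nondecreasing_seq B.
  move=> p n pn; apply/subsetPset; apply: (sub_cell w_gt0) => // [|j ji].
    rewrite /D !update_eq ler_pM2r ?least_gt0// lerD2l.
    by rewrite lef_pV2 ?posrE ?ltr0n// ler_nat ltnS.
  by rewrite /D !update_neq.
have mUB : measurable (\bigcup_n B n) by apply: bigcupT_measurable => n; exact: mcell.
have UB : (nu (\bigcup_n B n) <= (g i)%:E)%E.
  have := nondecreasing_cvg_mu (mu := nu) (fun n => mcell (D n) i) mUB ndB.
  move=> /cvg_lim <-//; apply: lime_le; last by near=> n; exact: Bg.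
  apply: ereal_nondecreasing_is_cvgn => p n pn /=.
  by apply: le_cell; apply/subsetPset/ndB.
apply: le_trans UB.
have lpos := least_gt0.
rewrite (@measure_eq_off_null _ _ _ nu (cell least i) (cell least i `&` \bigcup_n B n)
  (overlap Omega w least)) => //.
- by apply: le_measure => //; apply/mem_set => //; exact: measurableI.
- exact: measurableI.
- exact: overlap_measurable.
- exact: overlap_null.
apply/seteqP; split => x [xi nZ]; last by split => //; case: xi.
split => //; split => //.
have [Ox xij] := xi.
have strict j : j != i -> least i * w j x < least j * w i x.
  move=> ji; rewrite lt_neqAle xij andbT; apply/eqP => E.
  by apply: nZ; exists (i, j) => //=; rewrite eq_sym.
(* n is such that the slack in the strict inequalities absorbs the factor 1 + 1/(n+1) *)
pose ratio j := least i * w j x / (least j * w i x - least i * w j x).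
pose n := (\sum_j Num.truncn (ratio j))%N.
exists n => //; split => // j.
have [->|ji] := eqVneq j i; first by rewrite lexx.
rewrite /D update_eq update_neq// mulrDl mul1r mulrDl -lerBrDl -mulrA.
have gap : 0 < least j * w i x - least i * w j x by rewrite subr_gt0 strict.
rewrite ler_pdivrMl ?ltr0n// -ler_pdivrMr// ltW//.
apply: lt_le_trans (truncnS_gt _) _.
by rewrite ler_nat ltnS /n (bigD1 j)//= leq_addr.
Unshelve. all: by end_near. Qed.

(** If the cell of index [j != ord0] had less than its share, then multiplying the
[j]-th coordinate by a factor slightly less than 1 would enlarge this cell only
a little and shrink the others, giving an admissible family below [least]. *)
Lemma least_exact i : nu (cell least i) = (g i)%:E.
Proof.
have [lW0 lpos lg] := least_admissible.
have exact_neq0 j : j != ord0 -> nu (cell least j) = (g j)%:E.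
  move=> j0; apply/eqP; rewrite eq_le lg//= leNgt; apply/negP => lt_g.
  pose t n : R := 1 - n.+2%:R^-1.
  have t01 n : 0 < t n < 1.
    rewrite /t subr_gt0 invf_lt1 ?ltr0n// ltr1n/= ltrBlDr ltrDl invr_gt0 ltr0n//.
  pose D n := update least j (t n * least j).
  pose B n := cell (D n) j.
  have niB : nonincreasing_seq B.
    move=> p n pn; apply/subsetPset; apply: (sub_cell w_gt0) => // [|l lj].
      rewrite /D !update_eq ler_pM2r// lerD2l lerN2.
      by rewrite lef_pV2 ?posrE ?ltr0n// ler_nat !ltnS.
    by rewrite /D !update_neq.
  have IB : \bigcap_n B n = cell least j.
    apply/seteqP; split => x.
      move=> xB; have [Ox _] := xB 0%N I; split => // l.
      have [->//|lj] := eqVneq l j.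
      rewrite leNgt; apply/negP => gap.
      have gap0 : 0 < least j * w l x - least l * w j x by rewrite subr_gt0.
      pose n := Num.truncn (least j * w l x / (least j * w l x - least l * w j x)).
      have [_ /(_ l)] := xB n I.
      rewrite /D update_eq update_neq// -mulrA mulrBl mul1r lerBlDr -lerBlDl.
      apply/negP; rewrite -ltNge ltr_pdivrMl ?ltr0n// -ltr_pdivrMr//.
      apply: lt_trans (truncnS_gt _) _.
      by rewrite ltr_nat.
    move=> xj n _; apply: (sub_cell w_gt0) xj => // [|l lj].
      by rewrite /D update_eq ler_piMl ?ltW//; have /andP[] := t01 n.
    by rewrite /D update_neq.
  have cvgB : nu \o B @ \oo --> nu (cell least j).
    rewrite -IB; apply: nonincreasing_cvg_mu => //.
    - apply: le_lt_trans (ltry (\sum_l g l)); rewrite -nu_Omega.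
      by apply: le_measure; [exact/mem_set/mcell|exact/mem_set|move=> x []].
    - by move=> n; exact: mcell.
    - by rewrite IB; exact: mcell.
  have : \forall n \near \oo, (nu (B n) < (g j)%:E)%E.
    by apply: (cvgB (fun u => u < (g j)%:E)%E); exact: open_ereal_lt'.
  move=> [n _ /(_ n (leqnn n)) ltB].
  have DW : admissible (D n).
    have /andP[t0 t1] := t01 n.
    split => [|l|l l0].
    - by rewrite /D update_neq// eq_sym.
    - by rewrite /D /update; case: ifP => // _; rewrite mulr_gt0.
    have [->|lj] := eqVneq l j; first exact: ltW.
    apply: le_trans (lg l l0); apply: le_cell.
    apply: (sub_cell w_gt0) => [|l' l'l]; first by rewrite /D update_neq.
    rewrite /D /update; case: eqP => // ->.
    by rewrite ler_piMl// ltW.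
  have := least_le j DW; rewrite /D update_eq leNgt => /negP; apply.
  by rewrite gtr_pMl//; have /andP[] := t01 n.
have [->|] := eqVneq i ord0; last exact: exact_neq0.
have := sum_cells w_gt0 mcell minterface interface_null lpos mOmega.
rewrite nu_Omega !big_ord_recl (eq_bigr (fun i : 'I_k => (g (lift ord0 i))%:E)); last first.
  by move=> j _; rewrite exact_neq0.
rewrite sumEFin EFinD.
by move=> /(congr1 (fun u => u - (\sum_(j < k) g (lift ord0 j))%:E)%E); rewrite !addeK.
Qed.
End cell_existence.

(** * Uniqueness of parameters with prescribed cell measures *)

Lemma comparison_closed {R : realType} {T : topologicalType} (f h : T -> R) (s t : R) :
  continuous f -> continuous h -> closed [set x | s * f x <= t * h x].
Proof.
move=> cf ch.
rewrite (_ : [set x | _] = (fun x => t * h x - s * f x) @^-1` [set u | 0 <= u]).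
  apply: closed_comp; last exact: closed_ge.
  by move=> x _; apply: cvgB; apply: cvgM; try exact: cvg_cst; [exact: ch|exact: cf].
by apply/seteqP; split => x /=; rewrite subr_ge0.
Qed.

Section cell_uniqueness.
Context {R : realType} {n k : nat}.
Variables (nu : {measure set (surfaceType R n) -> \bar R}) (Omega : set 'rV[R]_n).
Variables (w : 'I_k.+1 -> 'rV[R]_n -> R).
Implicit Types (b c : 'I_k.+1 -> R) (i j : 'I_k.+1).

Hypothesis Omega_closed : closed Omega.
Hypothesis w_continuous : forall i, continuous (w i).

Lemma cell_closed b i : closed (cell Omega w b i).
Proof.
rewrite (_ : cell _ _ _ _ = Omega `&` \bigcap_j [set x | b i * w j x <= b j * w i x]).
  by apply: closedI => //; apply: closed_bigI => j _; apply: comparison_closed; exact: w_continuous.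
apply/seteqP; split => x [Ox xi]; split => //; first by move=> j _; exact: xi.
by move=> j; exact: xi.
Qed.

Lemma interface_closed b i j : closed (interface Omega w b i j).
Proof.
rewrite (_ : interface _ _ _ _ _ = Omega `&`
  ([set x | b i * w j x <= b j * w i x] `&` [set x | b j * w i x <= b i * w j x])).
  by apply: closedI => //; apply: closedI; apply: comparison_closed; exact: w_continuous.
apply/seteqP; split => x [Ox]; first by move=> /= ->; split => //; split.
by move=> [/= le1 le2]; split => //; apply/eqP; rewrite eq_le le1 le2.
Qed.

Hypothesis w_gt0 : forall i x, Omega x -> 0 < w i x.
Hypothesis Omega_connected : connected Omega.
Hypothesis interface_null : forall b i j, (forall l, 0 < b l) -> i != j ->
  nu (interface Omega w b i j) = 0%E.
Hypothesis open_gt0 : forall V : set 'rV[R]_n, open V -> V `&` Omega !=set0 ->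
  (0 < nu (V `&` Omega))%E.

(** Where [b / c] is maximal, the cells of [b] avoid the cells of [c] at the other
indices; the two unions [K] and [L] are closed, disjoint, and fill [Omega] up to
a relatively open null set, hence fill it. *)
Lemma cell_measures_inj_le b c (g : 'I_k.+1 -> R) :
  (forall i, 0 < b i) -> (forall i, 0 < c i) -> (forall i, 0 < g i) ->
  b ord0 = c ord0 ->
  (forall i, nu (cell Omega w b i) = (g i)%:E) ->
  (forall i, nu (cell Omega w c i) = (g i)%:E) ->
  forall i, b i <= c i.
Proof.
move=> b0 c0 g0 bc0 bg cg i0; rewrite leNgt; apply/negP => i0lt.
have mcell e i : measurable (cell Omega w e i : set (surfaceType R n)).
  exact/closed_surface_measurable/cell_closed.
have minterface e i j : measurable (interface Omega w e i j : set (surfaceType R n)).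
  exact/closed_surface_measurable/interface_closed.
have [i1 _ i1max] := arg_maxP (fun i => b i / c i) (isT : xpredT i0).
pose r := b i1 / c i1.
have rle i : b i <= r * c i by rewrite -ler_pdivrMr//; exact: i1max.
have r1 : 1 < r by apply: lt_le_trans (i1max i0 isT); rewrite ltr_pdivlMr// mul1r.
pose I : pred 'I_k.+1 := fun i => b i == r * c i.
have I0 : ~~ I ord0 by rewrite /I bc0 lt_eqF// ltr_pMl.
have I1 : I i1 by rewrite /I /r divfK// gt_eqF.
pose K := \bigcup_(i in [set i | I i]) cell Omega w b i.
pose L := \bigcup_(j in [set j | ~~ I j]) cell Omega w c j.
have clK : closed K.
  by apply: closed_bigcup => [|i _]; [exact: finite_finset|exact: cell_closed].
have clL : closed L.
  by apply: closed_bigcup => [|i _]; [exact: finite_finset|exact: cell_closed].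
have KO : K `<=` Omega by move=> x [i _ []].
have LO : L `<=` Omega by move=> x [i _ []].
have KL x : K x -> L x -> False.
  move=> [i Ii [Ox xi]] [j nIj [_ xj]].
  have bj : b j < r * c j by rewrite lt_neqAle nIj rle.
  have := xi j; have := xj i; move/eqP: Ii => ->.
  have wi := w_gt0 i Ox.
  rewrite -(ler_pM2l (lt_trans ltr01 r1)) !mulrA => h1 h2.
  have : b j * w i x < r * c j * w i x by rewrite ltr_pM2r.
  by rewrite ltNge (le_trans h1).
have mO : measurable (Omega : set (surfaceType R n)).
  exact: closed_surface_measurable.
have nuO : nu Omega = (\sum_i g i)%:E.
  rewrite -(@sum_cells _ (surfaceType R n) _ _ nu _ _ w_gt0 mcell minterface interface_null _ b0 mO) -sumEFin.
  by apply: eq_bigr => i _; rewrite bg.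
have nuK : nu K = (\sum_(i | I i) g i)%:E.
  rewrite -sumEFin (@measure_cells _ (surfaceType R n) _ _ nu _ _ mcell minterface interface_null)//.
  by apply: eq_bigr => i _; rewrite bg.
have nuL : nu L = (\sum_(i | ~~ I i) g i)%:E.
  rewrite -sumEFin (@measure_cells _ (surfaceType R n) _ _ nu _ _ mcell minterface interface_null)//.
  by apply: eq_bigr => i _; rewrite cg.
have mK : measurable (K : set (surfaceType R n)) by exact: closed_surface_measurable.
have mL : measurable (L : set (surfaceType R n)) by exact: closed_surface_measurable.
have KLO x : Omega x -> K x \/ L x.
  move=> Ox; apply: contrapT => /not_orP[nK nL].
  have : (0 < nu (~` (K `|` L) `&` Omega))%E.
    apply: open_gt0; first by apply: closed_openC; exact: closedU.
    by exists x; split => // -[].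
  rewrite setIC -setDE => pos.
  have KLE : Omega `&` (K `|` L) = K `|` L by apply/setIidr => y [/KO|/LO].
  have split_Omega : (nu Omega = nu (Omega `\` (K `|` L)) + nu (K `|` L))%E.
    by rewrite -[in X in (_ + X)%E]KLE; apply: measureDI => //; exact: measurableU.
  have split_KL : (nu (K `|` L) = nu K + nu L)%E.
    by apply: measureU => //; apply/seteqP; split => // y [Ky Ly]; exact: KL Ky Ly.
  move: split_Omega; rewrite split_KL nuK nuL -EFinD.
  have -> : \sum_(i | I i) g i + \sum_(i | ~~ I i) g i = \sum_i g i by rewrite [RHS](bigID I).
  rewrite nuO.
  move=> /(congr1 (fun u => u - (\sum_i g i)%:E)%E); rewrite addeK// subee//.
  by move=> E; rewrite -E ltxx in pos.
have nonempty i e : nu (cell Omega w e i) = (g i)%:E -> cell Omega w e i !=set0.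
  move=> eg; apply/set0P/eqP => E; move: eg; rewrite E measure0 => /esym/eqP.
  by rewrite eqe gt_eqF.
have [x xi1] := nonempty _ _ (bg i1).
have Kx : K x by exists i1.
have KE : K = Omega.
  apply: Omega_connected; first by exists x.
    exists (~` L); first exact: closed_openC.
    apply/seteqP; split => y; first by move=> Ky; split; [exact: KO|exact: KL].
    by move=> [/KLO[]].
  exists K => //; apply/seteqP; split => y; first by move=> Ky; split => //; exact: KO.
  by case.
have [y y0] := nonempty _ _ (cg ord0).
have Ly : L y by exists ord0.
by apply: (KL y) => //; rewrite KE; exact: LO.
Qed.

End cell_uniqueness.

(** * Measures with a density *)

Section density.
Context d (T : measurableType d) (R : realType).
Variables (mu : {measure set T -> \bar R}) (f : T -> \bar R).
Hypotheses (f_ge0 : forall x, (0 <= f x)%E) (mf : measurable_fun setT f).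

(** The proofs of nonnegativity and measurability are arguments so that the measure
structure can be attached to the function. *)
Definition density_measure of (forall x, (0 <= f x)%E) & measurable_fun setT f :
  set T -> \bar R := fun A => (\int[mu]_(x in A) f x)%E.

Local Notation nu := (density_measure f_ge0 mf).

Let nu0 : nu set0 = 0%E. Proof. exact: integral_set0. Qed.

Let nu_ge0 A : (0 <= nu A)%E. Proof. by apply: integral_ge0 => x _. Qed.

Let nu_sigma_additive : semi_sigma_additive nu.
Proof.
exact: semi_sigma_additive_nng_induced.
Qed.

HB.instance Definition _ := isMeasure.Build _ _ _ nu nu0 nu_ge0 nu_sigma_additive.

Lemma density_measure_null A : measurable A -> mu A = 0%E -> nu A = 0%E.
Proof.
move=> mA A0; apply: null_set_integral => //.
exact: measurable_funTS.
Qed.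

Lemma density_measure_gt0 A (N : set T) : measurable A -> measurable N ->
  mu N = 0%E -> (forall x, A x -> ~ N x -> (0 < f x)%E) -> (0 < mu A)%E ->
  (0 < nu A)%E.
Proof.
move=> mA mN N0 fpos A0; rewrite lt_neqAle nu_ge0 andbT eq_sym; apply/eqP => nuA0.
have mfA : measurable_fun A f by exact: measurable_funTS.
have : ae_eq mu A f (cst 0%E).
  apply/ae_eq_integral_abs => //; rewrite -[RHS]nuA0.
  by apply: eq_integral => x _; rewrite gee0_abs.
move=> [P [mP P0 fP]].
have : (mu A <= mu (N `|` P))%E.
  apply: le_measure; [exact/mem_set|exact/mem_set/measurableU|].
  move=> x Ax; have [Nx|nNx] := pselect (N x); [by left|right].
  by apply: fP => /= /(_ Ax) fx; move: (fpos x Ax nNx); rewrite fx ltxx.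
rewrite leNgt => /negP; apply.
apply: le_lt_trans A0; apply: le_trans (measureU2 mu mN mP) _.
have N0' : (mu N <= 0)%E by rewrite N0.
have P0' : (mu P <= 0)%E by rewrite P0.
by rewrite -[leRHS]adde0; exact: leeD N0' P0'.
Qed.
End density.

(** * The refractor map of a minimum of finitely many surfaces *)

Lemma continuous_cst_sub {R : realType} {T : topologicalType} (a : R) (f : T -> R) :
  continuous f -> continuous (fun x => a - f x).
Proof. by move=> cf x; apply: cvgB; [exact: cvg_cst|exact: cf]. Qed.

Lemma continuous_cst_div {R : realType} {T : topologicalType} (a : R) (f : T -> R) x :
  {for x, continuous f} -> f x != 0 -> {for x, continuous (fun y => a / f y)}.
Proof. by move=> cf fx; apply: cvgM; [exact: cvg_cst|exact: cvgV]. Qed.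

(** The last property lets measure estimates on relatively open parts of the
sphere pass to relatively open parts of [Omega], which may have points that are
not interior relative to the sphere. *)
Lemma closed_domain_props {R : realType} {n : nat} (N : 'rV[R]_n -> R)
    (Omega : set 'rV[R]_n) : is_norm N -> closed_domain (unit_sphere N) Omega ->
  [/\ closed Omega, connected Omega, Omega `<=` unit_sphere N &
      forall W : set 'rV[R]_n, open W -> W `&` Omega !=set0 ->
        exists2 V, open V & (V `&` unit_sphere N) !=set0 /\
          V `&` unit_sphere N `<=` W `&` Omega].
Proof.
move=> normN [V [oV V0 cV ->]]; split.
- exact: closed_closure.
- exact: connected_closure.
- apply: (@subset_trans _ (closure (unit_sphere N))).
    by apply: closureS; exact: subIsetr.
  by have /closure_id <- := unit_sphere_closed normN.
move=> W oW [x [Wx clx]].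
exists (W `&` V); first exact: openI.
split.
  have [y [[Vy Ny] Wy]] := clx W (open_nbhs_nbhs (conj oW Wx)).
  by exists y.
by move=> y [[Wy Vy] Ny]; split => //; exact: subset_closure.
Qed.

Lemma sup_lt1 {R : realType} {T : Type} (A : set T) (f : T -> R) :
  (ereal_sup [set (f x)%:E | x in A] < 1)%E ->
  exists2 kappa : R, kappa < 1 & forall x, A x -> f x <= kappa.
Proof.
move=> sup1.
have le_sup x : A x -> ((f x)%:E <= ereal_sup [set (f x)%:E | x in A])%E.
  by move=> Ax; apply: ereal_sup_ubound; exists x.
case: (ereal_sup _) sup1 le_sup => [r| |] //.
  by rewrite lte_fin => r1 le_r; exists r => // x /le_r; rewrite lee_fin.
by move=> _ leN; exists 0 => // x /leN.
Qed.

Section refractor_cells.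
Context {R : realType} {n : nat}.
Variables (N1 N2 : 'rV[R]_n -> R) (Omega1 Omega2 : set 'rV[R]_n).
Hypotheses (N1_norm : is_norm N1) (N2_norm : is_norm N2).
Hypotheses (N1_C1 : C1_away_from0 N1) (N2_C1 : C1_away_from0 N2).
Hypothesis N2_strict : contains_no_segment (unit_sphere N2).
Variable kappa : R.
Hypotheses (kappa_lt1 : kappa < 1) (N2_le : forall x, N1 x = 1 -> N2 x <= kappa).
Hypothesis Omega1_sphere : Omega1 `<=` unit_sphere N1.
Hypothesis Omega2_sphere : Omega2 `<=` unit_sphere N2.
Hypothesis Omega12 : forall x y, Omega1 x -> Omega2 y -> 1 <= dotp y (grad N1 x).
Implicit Types (x y : 'rV[R]_n).

Definition weight y x : R := 1 - dotp x (grad N2 y).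

Lemma sphere_differentiable N : is_norm N -> C1_away_from0 N ->
  forall y : 'rV[R]_n, unit_sphere N y -> differentiable N y.
Proof. by move=> normN C1 y Ny; case: (C1 y (unit_sphere_neq0 normN Ny)). Qed.

Lemma weight_continuous y : continuous (weight y).
Proof.
by apply: continuous_cst_sub; exact: dotp_continuous.
Qed.

Lemma weight_bounded y x : Omega1 x -> Omega2 y -> 1 - kappa <= weight y x <= 2.
Proof.
move=> /Omega1_sphere Nx /Omega2_sphere Ny.
have dN := sphere_differentiable N2_norm N2_C1 Ny.
have := dotp_grad_le N2_norm x dN; have := dotp_grad_le N2_norm (- x) dN.
rewrite is_normN// -scaleN1r dotpZl mulN1r /weight.
have := N2_le Nx; move: kappa_lt1; lra.
Qed.

Lemma weight_gt0 y x : Omega1 x -> Omega2 y -> 0 < weight y x.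
Proof.
move=> Ox Oy; have /andP[+ _] := weight_bounded Ox Oy.
by apply: lt_le_trans; rewrite subr_gt0.
Qed.

Lemma hfun_le y y' x (b b' : R) : Omega1 x -> Omega2 y -> Omega2 y' ->
  (hfun N2 b y x <= hfun N2 b' y' x) = (b * weight y' x <= b' * weight y x).
Proof.
move=> Ox Oy Oy'; rewrite /hfun -/(weight y x) -/(weight y' x).
by rewrite ler_pdivrMr ?weight_gt0// mulrAC ler_pdivlMr ?weight_gt0.
Qed.

Lemma hfun_eq y y' x (b b' : R) : Omega1 x -> Omega2 y -> Omega2 y' ->
  hfun N2 b y x = hfun N2 b' y' x -> b * weight y' x = b' * weight y x.
Proof.
move=> Ox Oy Oy' h; apply/eqP; rewrite eq_le -!hfun_le//.
by rewrite h lexx.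
Qed.

Variables (k : nat) (m : 'I_k.+1 -> 'rV[R]_n).
Hypotheses (m_Omega2 : forall i, Omega2 (m i)) (m_inj : injective m).
Variable b : 'I_k.+1 -> R.
Hypothesis b_gt0 : forall i, 0 < b i.

Local Notation w := (fun i => weight (m i)).
Local Notation cell := (cell Omega1 w b).
Local Notation rho := (min_hfun N2 b m).

Lemma min_hfun_le i x : rho x <= hfun N2 (b i) (m i) x.
Proof. exact: bigmin_le_cond. Qed.

Lemma min_hfun_cell i x : cell i x -> rho x = hfun N2 (b i) (m i) x.
Proof.
move=> [Ox xi]; apply/eqP; rewrite eq_le min_hfun_le/=.
have hi j : hfun N2 (b i) (m i) x <= hfun N2 (b j) (m j) x.
  by rewrite hfun_le.
by apply: le_bigmin => // j _; exact: hi.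
Qed.

Lemma min_hfun_continuous : {within Omega1, continuous rho}.
Proof.
apply: continuous_in_subspaceT => x /set_mem Ox.
have ch i : {for x, continuous (hfun N2 (b i) (m i))}.
  apply: continuous_cst_div; first exact: weight_continuous.
  by rewrite gt_eqF// (weight_gt0 Ox (m_Omega2 i)).
rewrite /min_hfun; elim: (index_enum _) => [|i s IH].
  by under eq_fun do rewrite big_nil; exact: ch.
under eq_fun do rewrite big_cons.
exact: continuous_min.
Qed.

Let w_gt0 i x : Omega1 x -> 0 < w i x.
Proof. by move=> Ox; exact: weight_gt0. Qed.

Lemma cell_supports i x : cell i x -> supports N2 Omega1 rho x (m i) (b i).
Proof. by move=> xi; split; [move=> y _; exact: min_hfun_le|exact: min_hfun_cell]. Qed.

Lemma min_hfun_is_refractor : is_refractor N2 Omega1 Omega2 rho.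
Proof.
split; first exact: min_hfun_continuous.
  move=> x Ox; have [i xi] := cells_cover w_gt0 b Ox.
  by rewrite (min_hfun_cell xi) divr_gt0// w_gt0.
move=> x Ox; have [i xi] := cells_cover w_gt0 b Ox.
by exists (m i), (b i); split => //; exact: cell_supports.
Qed.

(** Near such a point the minimum is realised by the [i]-th surface alone and
[Omega1] fills the sphere, so a surface touching the refractor from above is in
contact with the [i]-th one. *)
Lemma interior_direction_unique i x y : cell i x -> ~ overlap Omega1 w b x ->
  ~ rel_boundary (unit_sphere N1) Omega1 x ->
  refractor_map N2 Omega1 Omega2 rho x y -> y = m i.
Proof.
move=> xi nox nbx [Oy [c c0 [rho_le rho_eq]]].
have [Ox x_le] := xi.
have Nx := Omega1_sphere Ox.
have near_Omega1 : \forall z \near x, N1 z = 1 -> Omega1 z.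
  pose F := closure (unit_sphere N1 `\` Omega1).
  have nFx : ~ F x.
    by move=> Fx; apply: nbx; split => //; split => //; exact: subset_closure.
  have : nbhs x (~` F).
    by apply: open_nbhs_nbhs; split => //; apply: closed_openC; exact: closed_closure.
  apply: filterS => z nFz Nz; apply: contrapT => nOz.
  by apply: nFz; apply: subset_closure.
have near_cell : \forall z \near x, forall j, b i * w j z <= b j * w i z.
  pose F := \bigcup_(j in [set j | j != i]) [set z | b j * w i z <= b i * w j z].
  have nFx : ~ F x.
    move=> [j /= ji xj]; apply: nox; exists (i, j); first by rewrite /= eq_sym.
    by split => //=; apply/eqP; rewrite eq_le x_le xj.
  have : nbhs x (~` F).
    apply: open_nbhs_nbhs; split => //; apply: closed_openC.
    apply: closed_bigcup => [|j _]; first exact: finite_finset.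
    by apply: comparison_closed; exact: weight_continuous.
  apply: filterS => z nFz j; have [->//|ji] := eqVneq j i.
  by rewrite leNgt; apply/negP => /ltW zj; apply: nFz; exists j.
have rhox : hfun N2 (b i) (m i) x = hfun N2 c y x by rewrite -min_hfun_cell.
apply: (@contact_unique _ _ N1 N2 x y (m i) c (b i)) => //; rewrite -/(weight _ _).
- exact: sphere_differentiable.
- by apply: sphere_differentiable => //; exact: Omega2_sphere.
- by apply: sphere_differentiable => //; exact: Omega2_sphere.
- exact: Omega2_sphere.
- exact: Omega2_sphere.
- exact: Omega12.
- exact: Omega12.
- exact: hfun_eq.
apply: filterS2 near_Omega1 near_cell => z Oz zi Nz.
rewrite -/(weight _ _) -hfun_le//; last exact: Oz.
rewrite -(min_hfun_cell (i := i)); last by split => //; exact: Oz.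
by apply: rho_le; exact: Oz.
Qed.

(** The set on the left need not be Borel; this comparison with a finite union of
cells makes it measurable by completeness, and computes its measure. *)
Lemma preimage_off_null (E : set 'rV[R]_n) :
  let Z := overlap Omega1 w b `|` rel_boundary (unit_sphere N1) Omega1 in
  refractor_preimage N2 Omega1 Omega2 rho E `\` Z =
  (\bigcup_(i in [set i | m i \in E]) cell i) `\` Z.
Proof.
move=> Z; apply/seteqP; split => x [].
  move=> [Ox [y [xy Ey]]] nZ; split => //.
  have [i xi] := cells_cover w_gt0 b Ox.
  exists i => //=; apply/mem_set; rewrite -(interior_direction_unique xi _ _ xy)//.
    by move=> ox; apply: nZ; left.
  by move=> bx; apply: nZ; right.
move=> [i /= Ei xi] nZ; split => //; split; first by case: xi.
exists (m i); split; last exact: set_mem.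
by split => //; exists (b i) => //; exact: cell_supports.
Qed.

End refractor_cells.

(** * The refractor problem with finitely many target points *)

Lemma set1_borel {R : realType} {n : nat} (x : 'rV[R]_n) :
  measurable ([set x] : set (borelType R n)).
Proof.
rewrite -[[set x]]setCK; apply: measurableC; apply: sub_sigma_algebra.
apply: closed_openC; apply: accessible_closed_set1.
exact/hausdorff_accessible/norm_hausdorff.
Qed.

Lemma surface_section_null {R : realType} {n : nat} (N : 'rV[R]_n -> R)
    (q : 'rV[R]_n) (c : R) : (2 <= n)%N -> is_norm N ->
  contains_no_segment (unit_sphere N) -> q != 0 ->
  surface_measure R n (unit_sphere N `&` [set x | dotp x q = c]) = 0%E.
Proof.
case: n N q => [//|d] N q d0 normN strict q0.
exact: sphere_section_null.
Qed.

Lemma surface_open_gt0 {R : realType} {n : nat} (N : 'rV[R]_n -> R)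
    (V : set 'rV[R]_n) : (2 <= n)%N -> is_norm N -> open V ->
  V `&` unit_sphere N !=set0 -> (0 < surface_measure R n (V `&` unit_sphere N))%E.
Proof.
case: n N V => [//|d] N V _ normN oV [x [Vx Nx]].
exact: sphere_open_gt0 Vx Nx.
Qed.

(** Pairing the equality with [y] and with [y'] gives [s <= t] and [t <= s]. *)
Lemma gradients_independent {R : realType} {n : nat} (N : 'rV[R]_n -> R)
    (y y' : 'rV[R]_n) (s t : R) : is_norm N -> contains_no_segment (unit_sphere N) ->
  differentiable N y -> differentiable N y' -> N y = 1 -> N y' = 1 ->
  0 < s -> 0 < t -> s *: grad N y = t *: grad N y' -> y = y'.
Proof.
move=> normN strict dy dy' Ny Ny' s0 t0 E.
have E1 : s = t * dotp y (grad N y').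
  by rewrite -dotpZr -E dotpZr dotp_grad_self// Ny mulr1.
have E2 : s * dotp y' (grad N y) = t.
  by rewrite -dotpZr E dotpZr dotp_grad_self// Ny' mulr1.
have := dotp_grad_le normN y' dy; rewrite Ny' => le1.
apply: (strict_norm_eq normN) => //.
by rewrite -(ler_pM2l t0) mulr1 -E1 -E2 ler_piMr// ltW.
Qed.

(** On the interface [dotp x q = b j - b i] for
[q = b j *: grad N2 (m i) - b i *: grad N2 (m j)], which is not zero. *)
Lemma interface_null {R : realType} {n k : nat} (N1 N2 : 'rV[R]_n -> R)
    (Omega1 : set 'rV[R]_n) (m : 'I_k.+1 -> 'rV[R]_n) (b : 'I_k.+1 -> R) i j :
  (2 <= n)%N -> is_norm N1 -> is_norm N2 ->
  contains_no_segment (unit_sphere N1) -> contains_no_segment (unit_sphere N2) ->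
  (forall l, differentiable N2 (m l)) -> (forall l, N2 (m l) = 1) -> injective m ->
  Omega1 `<=` unit_sphere N1 -> (forall l, 0 < b l) -> i != j ->
  surface_measure R n (interface Omega1 (fun l => weight N2 (m l)) b i j) = 0%E.
Proof.
move=> n2 normN1 normN2 strict1 strict2 dm Nm m_inj O1 b0 ij.
pose q := b j *: grad N2 (m i) - b i *: grad N2 (m j).
have q0 : q != 0.
  rewrite subr_eq0; apply: contraNneq ij => E; apply/eqP/m_inj.
  exact: (gradients_independent normN2 strict2 _ _ _ _ (b0 j) (b0 i) E).
apply/eqP; rewrite eq_le hausdorff_ge0 andbT.
rewrite -(surface_section_null (b j - b i) n2 normN1 strict1 q0).
apply: le_hausdorff => x [Ox xij]; split; first exact: O1.
by move: xij; rewrite /weight /= dotpBr !dotpZr; lra.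
Qed.

Theorem theorem5p6 (R : realType) (n : nat) (n_ge2 : (2 <= n)%N)
  (N1 N2 : 'rV[R]_n -> R) (Omega1 Omega2 : set 'rV[R]_n)
  (N1_norm : is_norm N1) (N2_norm : is_norm N2)
  (N1_C1 : C1_away_from0 N1) (N2_C1 : C1_away_from0 N2)
  (N1_strict : contains_no_segment (unit_sphere N1))
  (N2_strict : contains_no_segment (unit_sphere N2))
  (kappa_lt1 : (ereal_sup [set (N2 x)%:E | x in unit_sphere N1] < 1)%E)
  (Omega1_dom : closed_domain (unit_sphere N1) Omega1)
  (Omega2_dom : closed_domain (unit_sphere N2) Omega2)
  (Omega1_bd :
    surface_measure R n (rel_boundary (unit_sphere N1) Omega1) = 0%E)
  (Omega12 : (1 <= ereal_inf [set (dotp u.2 (grad N1 u.1))%:E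
                             | u in Omega1 `*` Omega2])%E)
  (f : 'rV[R]_n -> R)
  (f_L1 : (surface_measure R n).-integrable Omega1 (EFin \o f))
  (f_gt0 : {ae surface_measure R n, forall x, Omega1 x -> 0 < f x})
  (k : nat) (m : 'I_k.+1 -> 'rV[R]_n) (g : 'I_k.+1 -> R)
  (m_Omega2 : forall i, Omega2 (m i)) (m_inj : injective m)
  (g_gt0 : forall i, 0 < g i)
  (balance : (\int[surface_measure R n]_(x in Omega1) (f x)%:E
              = (\sum_(i < k.+1) g i)%:E)%E)
  (b1 : R) (b1_gt0 : 0 < b1) :
  let mu := discrete_measure (m : 'I_k.+1 -> borelType R n)
              (fun i => NngNum (ltW (g_gt0 i))) in
  let solves (b : 'I_k.+1 -> R) :=
    [/\ b ord0 = b1, forall i, 0 < b i &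
        is_weak_solution N2 Omega1 Omega2 f mu (min_hfun N2 b m)] in
  exists b : 'I_k.+1 -> R,
    [/\ solves b,
        forall b' : 'I_k.+1 -> R, solves b' -> forall i, b' i = b i &
        forall i, refractor_measure N2 Omega1 Omega2 (min_hfun N2 b m) f
                    [set m i] = (g i)%:E].
Proof.
move=> mu solves.
have [clO1 O1_connected O1_sphere O1_open] := closed_domain_props N1_norm Omega1_dom.
have [_ _ O2_sphere _] := closed_domain_props N2_norm Omega2_dom.
have [kappa kappa1 N2_le] := sup_lt1 kappa_lt1.
have O12 x y : Omega1 x -> Omega2 y -> 1 <= dotp y (grad N1 x).
  move=> Ox Oy; rewrite -lee_fin; apply: le_trans Omega12 _.
  by apply: ereal_inf_lbound; exists (x, y).
pose w i := weight N2 (m i).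
pose sigma : {measure set (surfaceType R n) -> \bar R} := surface_measure R n.
have mO1 : measurable (Omega1 : set (surfaceType R n)) by exact: closed_surface_measurable.
(* f is only positive almost everywhere, so its positive part is the density *)
pose F : surfaceType R n -> \bar R := ((EFin \o f)^\+ \_ Omega1)%E.
have F_ge0 x : (0 <= F x)%E by apply: erestrict_ge0 => y _; exact: funepos_ge0.
have mf : measurable_fun (Omega1 : set (surfaceType R n)) (EFin \o f).
  by have /integrableP[] := f_L1.
have mF : measurable_fun setT F.
  by apply/(measurable_restrictT _ mO1); exact: measurable_funepos.
pose nu : {measure set (surfaceType R n) -> \bar R} := density_measure sigma F_ge0 mF.
have [Nf [mNf Nf0 Nf_gt0]] := f_gt0.
have f_gt0' x : Omega1 x -> ~ Nf x -> 0 < f x.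
  by move=> Ox nNx; apply: contrapT => fx; apply: nNx; apply: Nf_gt0 => /= /(_ Ox).
have nuE A : measurable (A : set (surfaceType R n)) -> A `<=` Omega1 ->
    (\int[surface_measure R n]_(x in A) (f x)%:E)%E = nu A.
  move=> mA AO.
  have mfA : measurable_fun (A : set (surfaceType R n)) (EFin \o f).
    exact: measurable_funS mf.
  transitivity (\int[surface_measure R n]_(x in A) (EFin \o f)^\+ x)%E.
    apply: ae_eq_integral => //; first exact: measurable_funepos.
    exists Nf; split => // x /= nx; apply: contrapT => nNx; apply: nx => Ax.
    by rewrite funeposE max_l// lee_fin ltW// f_gt0'//; exact: AO.
  apply: eq_integral => x /set_mem Ax; rewrite /F patchT//; exact/mem_set/AO.
have w_gt0 i x : Omega1 x -> 0 < w i x.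
  by move=> Ox; apply: (@weight_gt0 _ _ N1 N2 Omega1 Omega2 _ _ kappa).
have w_continuous i : continuous (w i) by exact: weight_continuous.
have mcell b i : measurable (cell Omega1 w b i : set (surfaceType R n)).
  by apply: closed_surface_measurable; exact: cell_closed.
have minterface b i j : measurable (interface Omega1 w b i j : set (surfaceType R n)).
  by apply: closed_surface_measurable; exact: interface_closed.
have dm i : differentiable N2 (m i).
  by apply: sphere_differentiable => //; exact: O2_sphere.
have Nm i : N2 (m i) = 1 by exact: O2_sphere.
have sigma_interface b i j : (forall l, 0 < b l) -> i != j ->
    sigma (interface Omega1 w b i j) = 0%E.
  by move=> b0 ij; apply: (interface_null (N1 := N1)).
have nu_interface b i j : (forall l, 0 < b l) -> i != j ->
    nu (interface Omega1 w b i j) = 0%E.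
  by move=> b0 ij; apply: density_measure_null => //; exact: sigma_interface.
have nu_Omega : nu Omega1 = (\sum_i g i)%:E by rewrite -nuE.
have nu_open (V : set 'rV[R]_n) : open V -> V `&` Omega1 !=set0 ->
    (0 < nu (V `&` Omega1))%E.
  move=> oV VO; have [W oW [WS0 WSO]] := O1_open V oV VO.
  have mW : measurable (W `&` unit_sphere N1 : set (surfaceType R n)).
    rewrite -[W]setCK; apply: measurableI; last first.
      by apply: closed_surface_measurable; exact: unit_sphere_closed.
    by apply: measurableC; apply: closed_surface_measurable; exact: open_closedC.
  have mV : measurable (V `&` Omega1 : set (surfaceType R n)).
    rewrite -[V]setCK; apply: measurableI => //.
    by apply: measurableC; apply: closed_surface_measurable; exact: open_closedC.
  apply: (@lt_le_trans _ _ (nu (W `&` unit_sphere N1))); last first.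
    by apply: le_measure; [exact/mem_set|exact/mem_set|].
  apply: (@density_measure_gt0 _ _ _ sigma F F_ge0 mF _ Nf) => //.
    move=> x /WSO[_ Ox] nNx; rewrite /F patchT; last exact/mem_set.
    by rewrite funeposE lt_max lte_fin f_gt0'.
  exact: surface_open_gt0.
have measure_formula b (E : set 'rV[R]_n) : (forall l, 0 < b l) ->
    refractor_measure N2 Omega1 Omega2 (min_hfun N2 b m) f E
    = (\sum_(i | m i \in E) nu (cell Omega1 w b i))%E.
  move=> b0.
  pose Z := overlap Omega1 w b `|` rel_boundary (unit_sphere N1) Omega1.
  have mo : measurable (overlap Omega1 w b : set (surfaceType R n)).
    exact: overlap_measurable.
  have mbd : measurable (rel_boundary (unit_sphere N1) Omega1 : set (surfaceType R n)).
    apply: closed_surface_measurable; apply: closedI; last exact: closed_closure.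
    by apply: closedI; [exact: unit_sphere_closed|exact: closed_closure].
  have mZ : measurable (Z : set (surfaceType R n)) by exact: measurableU.
  have Z0 : sigma Z = 0%E.
    apply/eqP; rewrite eq_le measure_ge0 andbT.
    apply: le_trans (measureU2 sigma mo mbd) _.
    have o0 : (sigma (overlap Omega1 w b) <= 0)%E.
      by rewrite (@overlap_null _ (surfaceType R n) _ _ sigma)// => c i j; exact: sigma_interface.
    have bd0 : (sigma (rel_boundary (unit_sphere N1) Omega1) <= 0)%E.
      by have -> : sigma (rel_boundary (unit_sphere N1) Omega1) = 0%E by exact: Omega1_bd.
    by rewrite -[leRHS]adde0; exact: leeD o0 bd0.
  have nuZ : nu Z = 0%E by exact: density_measure_null.
  pose U := \bigcup_(i in [set i | m i \in E]) cell Omega1 w b i.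
  have mU : measurable (U : set (surfaceType R n)).
    by apply: fin_bigcup_measurable => [|i _]; [exact: finite_finset|].
  pose P := refractor_preimage N2 Omega1 Omega2 (min_hfun N2 b m) E.
  have PU : P `\` Z = U `\` Z.
    exact: (@preimage_off_null _ _ N1 N2 Omega1 Omega2 _ _ _ _ _ kappa).
  have mP : measurable (P : set (surfaceType R n)).
    have -> : P = (U `\` Z) `|` (P `&` Z) by rewrite -PU setUC setUIDK.
    apply: measurableU; first exact: measurableD.
    by apply: measure_is_complete_caratheodory; exists Z; split => //; exact: subIsetr.
  rewrite /refractor_measure -/P nuE//; last by move=> x [].
  rewrite (measure_eq_off_null mP mU mZ nuZ PU).
  exact: (@measure_cells _ (surfaceType R n) _ _ nu).
have dirac_sum (E : set (borelType R n)) : mu E = (\sum_(i | m i \in E) (g i)%:E)%E.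
  rewrite /mu /discrete_measure [RHS]big_mkcond/=; apply: eq_bigr => i _.
  by rewrite diracE; case: ifP => _; rewrite ?mule1 ?mule0.
have sum1 i (h : 'I_k.+1 -> \bar R) : (\sum_(j | m j \in [set m i]) h j)%E = h i.
  rewrite (eq_bigl (fun j => j == i)) ?big_pred1_eq// => j.
  by apply/idP/eqP => [/set_mem/m_inj//|->]; exact/mem_set.
have solves_cells b : (forall i, 0 < b i) ->
    (forall i, nu (cell Omega1 w b i) = (g i)%:E) ->
    is_weak_solution N2 Omega1 Omega2 f mu (min_hfun N2 b m).
  move=> b0 bg; split.
    exact: (@min_hfun_is_refractor _ _ N1 N2 Omega1 Omega2 _ _ kappa).
  move=> E _ _; rewrite measure_formula//; apply: (eq_trans _ (esym (dirac_sum E))).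
  by apply: eq_bigr => i _; rewrite bg.
have cells_solves b : solves b -> forall i, nu (cell Omega1 w b i) = (g i)%:E.
  move=> [_ b0 [_ bE]] i.
  have subE : [set m i] `<=` Omega2 by move=> _ ->.
  have := etrans (esym (measure_formula b [set m i] b0))
    (etrans (bE [set m i] (set1_borel (m i)) subE) (dirac_sum [set m i])).
  by rewrite !sum1.
have w_bounded i x : Omega1 x -> 1 - kappa <= w i x <= 2.
  by move=> Ox; apply: (@weight_bounded _ _ N1 N2 Omega1 Omega2).
have kappa'0 : 0 < 1 - kappa by rewrite subr_gt0.
pose b := least nu Omega1 w g b1.
have [b_ord0 b_gt0 _] : admissible nu Omega1 w g b1 b.
  exact: (@least_admissible _ (surfaceType R n) _ _ nu _ _ w_gt0 mcell minterface
    nu_interface mO1 _ _ kappa'0 w_bounded).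
have b_cells i : nu (cell Omega1 w b i) = (g i)%:E.
  exact: (@least_exact _ (surfaceType R n) _ _ nu _ _ w_gt0 mcell minterface
    nu_interface mO1 _ _ kappa'0 w_bounded).
exists b; split.
- by split => //; exact: solves_cells.
- move=> b' sb' i; have [b'_ord0 b'_gt0 _] := sb'; have b'_cells := cells_solves _ sb'.
  have inj_le := @cell_measures_inj_le _ _ _ nu _ _ clO1 w_continuous w_gt0
    O1_connected nu_interface nu_open.
  have b'b : b' ord0 = b ord0 by rewrite b'_ord0.
  apply/eqP; rewrite eq_le; apply/andP; split.
    exact: (inj_le b' b g b'_gt0 b_gt0 g_gt0 b'b b'_cells b_cells i).
  exact: (inj_le b b' g b_gt0 b'_gt0 g_gt0 (esym b'b) b_cells b'_cells i).
- by move=> i; rewrite measure_formula// sum1.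
Qed.
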